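(* Let $[\mathcal{A},\|\cdot\|_{\mathcal{A}}]$ be a normed operator ideal and let $[\mathcal{I}^{\mathcal{H}_v^\infty},\|\cdot\|_{\mathcal{I}^{\mathcal{H}_v^\infty}}]$ be a normed weighted holomorphic ideal that has the linearization property (LP) in $\mathcal{A}$. Then $$[\mathcal{A}\circ(\mathcal{A}^{-1}\circ\mathcal{I}^{\mathcal{H}_v^\infty}),\|\cdot\|_{\mathcal{A}\circ(\mathcal{A}^{-1}\circ\mathcal{I}^{\mathcal{H}_v^\infty})}]=[\mathcal{I}^{\mathcal{H}_v^\infty},\|\cdot\|_{\mathcal{I}^{\mathcal{H}_v^\infty}}].$$
   Context: All Banach spaces are complex. A weight $v$ on an open subset $U$ of a Banach space $E$ is a strictly positive continuous function on $U$; whenever an open set $U$ is considered, it carries a weight denoted $v$ (open subsets of $U$ carry the restriction). $\mathcal{H}_v^\infty(U,F)$ is the Banach space of holomorphic $f:U\to F$ with $\|f\|_v:=\sup_{x\in U}v(x)\|f(x)\|<\infty$, and $\mathcal{H}_v^\infty(U)=\mathcal{H}_v^\infty(U,\mathbb{C})$. Linearization: $\mathcal{G}_v^\infty(U)\subset\mathcal{H}_v^\infty(U)^*$ is the canonical predual of $\mathcal{H}_v^\infty(U)$, the norm-closed linear span of the evaluations $\delta_x$, $\delta_x(f)=f(x)$, $x\in U$. The map $\Delta_v:U\to\mathcal{G}_v^\infty(U)$, $\Delta_v(x)=\delta_x$, belongs to $\mathcal{H}_v^\infty(U,\mathcal{G}_v^\infty(U))$, and for every $f\in\mathcal{H}_v^\infty(U,F)$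 there is a unique $T_f\in\mathcal{L}(\mathcal{G}_v^\infty(U),F)$ with $T_f\circ\Delta_v=f$; moreover $\|T_f\|=\|f\|_v$. A normed (Banach) weighted holomorphic ideal $[\mathcal{I}^{\mathcal{H}_v^\infty},\|\cdot\|_{\mathcal{I}^{\mathcal{H}_v^\infty}}]$ assigns to every pair $(U,F)$ ($U$ open in a Banach space $E$, $F$ a Banach space) a set $\mathcal{I}^{\mathcal{H}_v^\infty}(U,F)\subseteq\mathcal{H}_v^\infty(U,F)$ and a function $\|\cdot\|_{\mathcal{I}^{\mathcal{H}_v^\infty}}$ on it such that: (P1) it is a normed (Banach) space and $\|f\|_{\mathcal{I}^{\mathcal{H}_v^\infty}}\ge\|f\|_v$; (P2) for $h\in\mathcal{H}_v^\infty(U)$, $y\in F$, the map $h\cdot y:x\mapsto h(x)y$ belongs to it with norm $\|h\|_v\|y\|$; (P3) if $V\subseteq U$ is open in $E$, $h:V\to U$ is holomorphic with $c_v(h):=\sup_{x\in V}v(x)/v(h(x))<\infty$, $f\in\mathcal{I}^{\mathcal{H}_v^\infty}(U,F)$ and $T\in\mathcal{L}(F,G)$, then $T\circ f\circ h\in\mathcal{I}^{\mathcal{H}_v^\infty}(V,G)$ with norm at most $\|T\|\,\|f\|_{\mathcal{I}^{\mathcal{H}_v^\infty}}c_v(h)$. Normed operator ideals are understood in the usual sense of Pietsch. LP: $\mathcal{I}^{\mathcal{H}_v^\infty}$ has the linearization property in $\mathcal{A}$ if for every $f\in\mathcal{H}_v^\infty(U,F)$: $f\in\mathcal{I}^{\mathcal{H}_v^\infty}(U,F)$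 iff $T_f\in\mathcal{A}(\mathcal{G}_v^\infty(U),F)$, and in that case $\|f\|_{\mathcal{I}^{\mathcal{H}_v^\infty}}=\|T_f\|_{\mathcal{A}}$. Left-hand quotient: $f\in\mathcal{H}_v^\infty(U,F)$ belongs to $\mathcal{A}^{-1}\circ\mathcal{I}^{\mathcal{H}_v^\infty}(U,F)$ if $A\circ f\in\mathcal{I}^{\mathcal{H}_v^\infty}(U,G)$ for every Banach space $G$ and every $A\in\mathcal{A}(F,G)$; its norm is $\sup\{\|A\circ f\|_{\mathcal{I}^{\mathcal{H}_v^\infty}}:A\in\mathcal{A}(F,G),\ \|A\|_{\mathcal{A}}\le1\}$, $G$ ranging over all Banach spaces. Composition ideal: for a weighted holomorphic ideal $\mathcal{J}$, $f\in\mathcal{A}\circ\mathcal{J}(U,F)$ if $f=A\circ g$ for some Banach space $G$, $A\in\mathcal{A}(G,F)$, $g\in\mathcal{J}(U,G)$; $\|f\|_{\mathcal{A}\circ\mathcal{J}}:=\inf\|A\|_{\mathcal{A}}\|g\|_{\mathcal{J}}$ over all such factorizations. Equality of ideals means equality of the sets for all $(U,F)$ and of the norms. *)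

(* Defs.v *)
From HB Require Import structures.
From mathcomp Require Import all_boot all_order all_algebra complex.
From mathcomp Require Import all_classical all_reals.
From mathcomp Require Import ereal topology normedtype landau derive.

Set Implicit Arguments.
Unset Strict Implicit.
Unset Printing Implicit Defensive.

Import Order.TTheory GRing.Theory Num.Theory.
Import numFieldNormedType.Exports.

Local Open Scope classical_set_scope.
Local Open Scope ring_scope.
Local Open Scope complex_scope.

Section RealNorm.
Context {R : realType} {V : normedModType R[i]}.
Implicit Types x y : V.

(* The library norm of a normedModType R[i] is R[i]-valued. *)
Definition rnorm x : R := complex.Re `|x|.

Lemma rnormE x : `|x| = (rnorm x)%:C.
Proof.
have := normr_ge0 x; rewrite /rnorm lecE /= => /andP[/eqP h _].
by case: (`|x|) h => a b /= ->.
Qed.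

Lemma rnorm_ge0 x : 0 <= rnorm x.
Proof. by rewrite -ler0c -rnormE. Qed.

Lemma rnorm0 : rnorm (0 : V) = 0.
Proof. by rewrite /rnorm normr0. Qed.

Lemma rnorm0_eq0 x : rnorm x = 0 -> x = 0.
Proof. by move=> h; apply/eqP; rewrite -normr_eq0 rnormE h. Qed.

Lemma ler_rnormD x y : rnorm (x + y) <= rnorm x + rnorm y.
Proof. by rewrite -lecR rmorphD /= -!rnormE ler_normD. Qed.

Lemma rnormZ (a : R[i]) x : rnorm (a *: x) = complex.Re `|a| * rnorm x.
Proof.
rewrite /rnorm normrZ; have := normr_ge0 a; have := normr_ge0 x.
case: `|x| => x1 x2; case: `|a| => a1 a2; rewrite !lecE /=.
by move=> /andP[/eqP -> _] /andP[/eqP -> _]; rewrite mulr0 subr0.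
Qed.

End RealNorm.

Section ComplexComplete.
Variable R : realType.

Let Re_norm (z : R[i]) : `|complex.Re z| <= complex.Re `|z|.
Proof.
by have := normc_ge_Re z; rewrite lecE /= => /andP[].
Qed.

Let Im_norm (z : R[i]) : `|complex.Im z| <= complex.Re `|z|.
Proof.
rewrite normc_def /= -sqrtr_sqr ler_wsqrtr // lerDr.
exact: sqr_ge0.
Qed.

Let norm_ReIm (z : R[i]) :
  `|z| <= (`|complex.Re z| + `|complex.Im z|)%:C.
Proof.
rewrite normc_def lecR -[leRHS]ger0_norm ?addr_ge0 // -sqrtr_sqr.
apply: ler_wsqrtr; rewrite sqrrD !real_normK ?num_real // -addrA lerD2l.
by rewrite lerDr mulrn_wge0 // mulr_ge0.
Qed.

Lemma complex_complete (F : set_system R[i]^o) :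
  ProperFilter F -> cauchy F -> cvg F.
Proof.
move=> FF /cauchyP Fc.
have comp (p : R[i] -> R) :
    (forall z w, p (z - w) = p z - p w) ->
    (forall z, `|p z| <= complex.Re `|z|) -> cvg (p @ F).
  move=> pB pn; apply/cauchy_cvgP/cauchyP => e e0.
  have [|z Fz] := Fc e%:C; first by rewrite ltcR.
  exists (p z); rewrite /= nbhs_filterE /fmap /=.
  apply: filterS Fz => w; rewrite -!ball_normE /ball_ /= => zw.
  rewrite -pB (le_lt_trans (pn _)) //.
  by move: zw; rewrite ltcE /= => /andP[].
have ReF := comp (@complex.Re R) (fun z w => raddfB _ z w) Re_norm.
have ImF := comp (@complex.Im R) (fun z w => raddfB _ z w) Im_norm.
move/cvg_ex: ReF => [a /cvgrPdist_lt Fa]; move/cvg_ex: ImF => [b /cvgrPdist_lt Fb].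
apply/cvg_ex; exists (a +i* b); apply/fcvgrPdist_lt => e e0.
have e2 : 0 < complex.Re e / 2.
  by rewrite divr_gt0 //; move: e0; rewrite ltcE => /andP[].
apply: (filterS2 _ _ (Fa _ e2) (Fb _ e2)) => z /= az bz.
apply: le_lt_trans (norm_ReIm _) _.
have -> : e = (complex.Re e)%:C.
  by move: e0; rewrite ltcE; case: (e) => x y /= /andP[/eqP ->].
rewrite ltcR; case: z az bz => x y /= az bz.
by rewrite [ltRHS]splitr ltrD.
Qed.

(* The library's completeness instance for _^o is restricted to realType, so
   the Banach space of scalars is declared on R[i] itself. *)
HB.instance Definition _ := NormedModule.copy R[i] R[i]^o.
HB.instance Definition _ := Uniform_isComplete.Build R[i] complex_complete.

End ComplexComplete.

Section Operators.
Context {R : realType} (V W : normedModType R[i]).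

Definition is_operator : {pred V -> W} :=
  [pred f : V -> W | `[< linear f /\ continuous f >]].

Record operator := Operator {
  operator_fun :> V -> W;
  _ : operator_fun \in is_operator }.

HB.instance Definition _ := [isSub for operator_fun].
HB.instance Definition _ := [Choice of operator by <:].

Lemma operator_linear (T : operator) : linear T.
Proof. by case: T => f /= /asboolP[]. Qed.

Lemma operator_continuous (T : operator) : continuous T.
Proof. by case: T => f /= /asboolP[]. Qed.

HB.instance Definition _ (T : operator) :=
  GRing.isLinear.Build R[i] V W *:%R (operator_fun T) (operator_linear T).

Lemma bounded_is_operator (f : V -> W) (M : R) :
  linear f -> (forall x, rnorm (f x) <= M * rnorm x) -> f \in is_operator.
Proof.
move=> fl fM; apply/asboolP; split=> //.
pose g : {linear V -> W} := HB.pack f (GRing.isLinear.Build R[i] V W *:%R f fl).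
apply: (@bounded_linear_continuous _ _ _ g); apply/linear_boundedP.
exists (Num.max M 0)%:C; split.
  by rewrite ger0_real // ler0c le_max lexx orbT.
move=> r Mr x /=; rewrite !rnormE.
rewrite (@le_trans _ _ (Num.max M 0 * rnorm x)%:C) //.
  by rewrite lecR (le_trans (fM x)) // ler_wpM2r ?rnorm_ge0 // le_max lexx.
by rewrite rmorphM ler_wpM2r ?(ltW Mr) // ler0c rnorm_ge0.
Qed.

Lemma is_operator_submod : submod_closed is_operator.
Proof.
split.
  apply/asboolP; split; last exact: cst_continuous.
  by move=> a u v /=; rewrite scaler0 addr0.
move=> a f g /asboolP[fl fc] /asboolP[gl gc]; apply/asboolP; split.
  move=> b u v; rewrite !fctE fl gl !scalerDr !scalerA (mulrC a b).
  by rewrite addrACA.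
by move=> x; apply: cvgD; [apply: cvgZl_tmp; exact: fc|exact: gc].
Qed.

HB.instance Definition _ :=
  GRing.isSubmodClosed.Build _ _ is_operator is_operator_submod.
HB.instance Definition _ := [SubChoice_isSubLmodule of operator by <:].

Definition opnorm (T : V -> W) : R :=
  sup [set rnorm (T x) | x in [set x | rnorm x <= 1]].

Lemma has_sup_opnorm (T : operator) :
  has_sup [set rnorm (T x) | x in [set x | rnorm x <= 1]].
Proof.
split; first by exists (rnorm (T 0)), 0 => //=; rewrite rnorm0 ler01.
have /linear_boundedP/pinfty_ex_gt0[M M0 TM] :=
  continuous_linear_bounded 0 (@operator_continuous T 0).
exists (complex.Re M) => _ [x /= x1 <-].
have := TM x; rewrite !rnormE.
case: M M0 {TM} => M M'; rewrite ltcE lecE /= => /andP[/eqP-> M0] /andP[_].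
rewrite mul0r subr0 => /le_trans; apply.
by rewrite ler_piMr // ltW.
Qed.

Lemma opnorm_ge0 (T : operator) : 0 <= opnorm T.
Proof.
rewrite (le_trans (rnorm_ge0 (T 0))) //.
apply: sup_upper_bound; first exact: has_sup_opnorm.
by exists 0 => //=; rewrite rnorm0 ler01.
Qed.

Lemma le_opnorm (T : operator) x : rnorm (T x) <= opnorm T * rnorm x.
Proof.
have [->|x0] := eqVneq x 0; first by rewrite linear0 !rnorm0 mulr0.
have nx0 : 0 < rnorm x.
  by rewrite lt_neqAle rnorm_ge0 andbT eq_sym; apply: contra_neq x0 => /rnorm0_eq0.
have Re_inv : complex.Re `|((rnorm x)^-1)%:C| = (rnorm x)^-1.
  by rewrite ger0_norm // ler0c invr_ge0 rnorm_ge0.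
rewrite -ler_pdivrMr // mulrC -[X in X * _]Re_inv -rnormZ -linearZ.
apply: sup_upper_bound; first exact: has_sup_opnorm.
exists (((rnorm x)^-1)%:C *: x) => //=.
by rewrite rnormZ Re_inv mulVf // gt_eqF.
Qed.

Lemma opnorm_le (T : operator) M : 0 <= M ->
  (forall x, rnorm (T x) <= M * rnorm x) -> opnorm T <= M.
Proof.
move=> M0 TM; apply: ge_sup; first by case: (has_sup_opnorm T).
by move=> _ [x /= x1 <-]; rewrite (le_trans (TM x)) // ler_piMr.
Qed.

Lemma opnormD (S T : operator) :
  (opnorm (S + T))%:C <= (opnorm S)%:C + (opnorm T)%:C :> R[i].
Proof.
rewrite -rmorphD lecR; apply: opnorm_le => [|x].
  by rewrite addr_ge0 // opnorm_ge0.
by rewrite mulrDl (le_trans (ler_rnormD _ _)) // lerD // le_opnorm.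
Qed.

Lemma opnormZ (a : R[i]) (T : operator) :
  (opnorm (a *: T))%:C = `|a| * (opnorm T)%:C :> R[i].
Proof.
have aE : `|a| = (complex.Re `|a|)%:C.
  have := normr_ge0 a; rewrite lecE.
  by case: `|a| => b c /= /andP[/eqP->].
have Ra0 : 0 <= complex.Re `|a| by rewrite -ler0c -aE.
have le b (S : operator) : opnorm (b *: S) <= complex.Re `|b| * opnorm S.
  apply: opnorm_le => [|x].
    rewrite mulr_ge0 // ?opnorm_ge0 //.
    by have := normr_ge0 b; rewrite lecE => /andP[].
  rewrite rnormZ -mulrA ler_wpM2l ?le_opnorm //.
  by have := normr_ge0 b; rewrite lecE => /andP[].
rewrite aE -rmorphM; congr (_%:C); apply/eqP; rewrite eq_le le andTb.
have [a0|a0] := eqVneq a 0.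
  by rewrite a0 normr0 mul0r opnorm_ge0.
have Ra : 0 < complex.Re `|a| by rewrite -ltcR -aE normr_gt0.
rewrite mulrC -ler_pdivlMr // mulrC.
have := le a^-1 (a *: T); rewrite scalerA mulVf // scale1r normfV aE.
by rewrite -fmorphV.
Qed.

Lemma opnorm0_eq0 (T : operator) : (opnorm T)%:C = 0 :> R[i] -> T = 0.
Proof.
move=> /(@complexI R _ 0) T0; apply/val_inj/funext => x /=.
apply: rnorm0_eq0; apply/eqP; rewrite eq_le rnorm_ge0 andbT.
by rewrite (le_trans (le_opnorm T x)) // T0 mul0r.
Qed.

HB.instance Definition _ :=
  Lmodule_isNormed.Build R[i] operator opnormD opnormZ opnorm0_eq0.

Lemma rnorm_operator (T : operator) : rnorm T = opnorm T.
Proof. by []. Qed.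

End Operators.

Section RealFilters.
Context {R : realType} {V : normedModType R[i]}.
Implicit Types x y : V.

Lemma rnormN x : rnorm (- x) = rnorm x.
Proof. by rewrite /rnorm normrN. Qed.

Let posC (e : R[i]) : 0 < e -> e = (complex.Re e)%:C /\ 0 < complex.Re e.
Proof. by case: e => a b; rewrite ltcE /= => /andP[/eqP->]. Qed.

Lemma fcvg_rnormP (F : set_system V) {FF : Filter F} y :
  F --> y <-> forall e : R, 0 < e -> F [set z | rnorm (y - z) < e].
Proof.
split=> [/fcvgrPdist_lt Fy e e0|Fy].
  have := Fy e%:C; rewrite ltcR => /(_ e0); apply: filterS => z.
  by rewrite rnormE ltcR.
apply/fcvgrPdist_lt => e /posC[-> e0]; apply: filterS (Fy _ e0) => z /=.
by rewrite rnormE ltcR.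
Qed.

Lemma cvg_rnormP T (F : set_system T) {FF : Filter F} (f : T -> V) y :
  f @ F --> y <-> forall e : R, 0 < e -> F [set t | rnorm (y - f t) < e].
Proof. exact: fcvg_rnormP. Qed.

Lemma cauchy_rnormP (F : set_system V) {FF : ProperFilter F} :
  cauchy F <->
  forall e : R, 0 < e -> exists x, F [set y | rnorm (x - y) < e].
Proof.
split=> [/cauchyP Fc e e0|Fc].
  have [|x Fx] := Fc e%:C; first by rewrite ltcR.
  exists x; apply: filterS Fx => y.
  by rewrite -ball_normE /ball_ /= rnormE ltcR.
apply/cauchyP => e /posC[-> e0]; have [x Fx] := Fc _ e0.
exists x; apply: filterS Fx => y.
by rewrite -ball_normE /ball_ /= rnormE ltcR.
Qed.

Lemma cvg_rnorm_le T (F : set_system T) {FF : ProperFilter F} (f : T -> V)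
    x y (e : R) :
  f @ F --> y -> F [set t | rnorm (x - f t) <= e] -> rnorm (x - y) <= e.
Proof.
move=> /cvg_rnormP fy Fe; apply/ler_addgt0Pr => d d0.
have [t /= [te ty]] := filter_ex (filterI Fe (fy _ d0)).
rewrite -(subrKA (f t)) (le_trans (ler_rnormD _ _)) // lerD //.
by rewrite -rnormN opprB ltW.
Qed.

End RealFilters.

Section OperatorComplete.
Context {R : realType} (V : normedModType R[i]) (W : completeNormedModType R[i]).

Lemma operator_complete (F : set_system (operator V W)) :
  ProperFilter F -> cauchy F -> cvg F.
Proof.
move=> FF /cauchy_rnormP Fc.
have ex x : exists y : W, (fun T : operator V W => T x) @ F --> y.
  apply/cvg_ex/cauchy_cvgP/cauchy_rnormP => e e0.
  have x1 : 0 < rnorm x + 1 by rewrite ltr_wpDl // rnorm_ge0.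
  have [T FT] := Fc _ (divr_gt0 e0 x1).
  exists (T x); apply: (@filterS _ F _ _ _ _ FT) => S /=.
  rewrite rnorm_operator => TS.
  have -> : T x - S x = (T - S) x by [].
  rewrite (le_lt_trans (le_opnorm _ _)) //.
  rewrite (@le_lt_trans _ _ (opnorm (T - S) * (rnorm x + 1))) //.
    by rewrite ler_wpM2l ?opnorm_ge0 // lerDl.
  by rewrite -ltr_pdivlMr.
have [g gE] := choice ex.
have gle T e : F [set S | rnorm (T - S) < e] ->
    forall x, rnorm (T x - g x) <= e * rnorm x.
  move=> FT x; apply: (cvg_rnorm_le (gE x)); apply: filterS FT => S /=.
  rewrite rnorm_operator => /ltW TS.
  rewrite (le_trans (le_opnorm (T - S) x)) // ler_wpM2r //.
  exact: rnorm_ge0.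
have gl : linear g.
  move=> a u v; apply: (cvg_unique _ (gE _)) => //=.
  have -> : (fun T : operator V W => T (a *: u + v)) =
            (a \*: (fun T : operator V W => T u)) \+
            (fun T : operator V W => T v).
    by apply/funext => T /=; rewrite linearP.
  by apply: cvgD; [apply: cvgZl_tmp|]; exact: gE.
have gP : g \in @is_operator R V W.
  have [T /gle gT] := Fc _ ltr01.
  apply: (bounded_is_operator (M := opnorm T + 1)) => // x.
  rewrite mulrDl -{1}[g x](subKr (T x)) (le_trans (ler_rnormD _ _)) //.
  by rewrite lerD ?le_opnorm // rnormN.
apply/cvg_ex; exists (Operator gP); apply/fcvg_rnormP => e e0.
have e4 : 0 < e / 2 / 2 by rewrite !divr_gt0.
have [T FT] := Fc _ e4; apply: filterS (FT) => S /= TS.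
rewrite -(subrKA T) (le_lt_trans (ler_rnormD _ _)) //.
rewrite (@le_lt_trans _ _ (e / 2 / 2 + e / 2 / 2)) //; last first.
  by rewrite -splitr ltr_pdivrMr // ltr_pMr // ltr1n.
rewrite lerD ?(ltW TS) // rnorm_operator; apply: opnorm_le => [|x].
  exact: ltW.
rewrite -rnormN (_ : - _ = T x - g x) ?gle //.
by rewrite -opprB opprK.
Qed.

HB.instance Definition _ := Uniform_isComplete.Build (operator V W)
  operator_complete.

End OperatorComplete.

Section ClosedSpan.
Context {R : realType} {V : completeNormedModType R[i]} (S : set V).

Definition span : set V :=
  [set x | exists n (a : 'I_n -> R[i]) (s : 'I_n -> V),
    (forall i, S (s i)) /\ x = \sum_(i < n) a i *: s i].

Definition in_closed_span : {pred V} := [pred x | `[< closure span x >]].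

Record closed_span := ClosedSpan {
  closed_span_val :> V;
  _ : closed_span_val \in in_closed_span }.

HB.instance Definition _ := [isSub for closed_span_val].
HB.instance Definition _ := [Choice of closed_span by <:].

Lemma closure_rnormP (A : set V) x :
  closure A x <-> forall e : R, 0 < e -> exists2 y, A y & rnorm (x - y) < e.
Proof.
split=> [Ax e e0|h B].
  have [|y [Ay xy]] := Ax [set y | rnorm (x - y) < e]; last by exists y.
  by have /fcvg_rnormP := @cvg_refl _ (nbhs x); apply.
move=> /nbhs_ballP[e /= e0 xB].
have eE : e = (complex.Re e)%:C.
  by move: e0; rewrite ltcE; case: (e) => a b /= /andP[/eqP->].
have [|y Ay xy] := h (complex.Re e); first by rewrite -ltcR -eE.
exists y; split=> //; apply: xB.
by rewrite -ball_normE /ball_ /= rnormE eE ltcR.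
Qed.

Lemma span_submod : span 0 /\
  forall (a : R[i]) x y, span x -> span y -> span (a *: x + y).
Proof.
split; first by exists 0, (fun=> 0), (fun=> 0); split; [case|rewrite big_ord0].
move=> a _ _ [m [b [s [Ss ->]]]] [n [c [t [St ->]]]].
exists (m + n)%N.
exists (fun i => match fintype.split i with inl j => a * b j | inr j => c j end).
exists (fun i => match fintype.split i with inl j => s j | inr j => t j end).
split; first by move=> i; case: (fintype.split i).
rewrite big_split_ord scaler_sumr; congr (_ + _); apply: eq_bigr => i _.
  by rewrite (unsplitK (inl i)) scalerA.
by rewrite (unsplitK (inr i)).
Qed.

Lemma in_closed_span_submod : submod_closed in_closed_span.
Proof.
have [span0 spanD] := span_submod.
split; first by apply/asboolP; exact: subset_closure.
move=> a x y /asboolP/closure_rnormP Cx /asboolP/closure_rnormP Cy.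
apply/asboolP/closure_rnormP => e e0.
have a0 : 0 <= complex.Re `|a|.
  by have := normr_ge0 a; rewrite lecE => /andP[].
have a1 : 0 < complex.Re `|a| + 1 by rewrite ltr_wpDl.
have e2 : 0 < e / 2 by rewrite divr_gt0.
have [x' Sx' xx'] := Cx _ (divr_gt0 e2 a1).
have [y' Sy' yy'] := Cy _ e2.
exists (a *: x' + y'); first exact: spanD.
rewrite opprD addrACA -scalerBr (le_lt_trans (ler_rnormD _ _)) //.
rewrite [ltRHS]splitr ler_ltD // rnormZ.
rewrite ltr_pdivlMr // in xx'; apply: le_trans (ltW xx').
by rewrite mulrC ler_wpM2l ?rnorm_ge0 // lerDl.
Qed.

HB.instance Definition _ :=
  GRing.isSubmodClosed.Build _ _ in_closed_span in_closed_span_submod.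
HB.instance Definition _ := [SubChoice_isSubLmodule of closed_span by <:].

Let norm (x : closed_span) : R[i] := `|val x|.

Let ler_normD x y : norm (x + y) <= norm x + norm y.
Proof. exact: ler_normD. Qed.

Let normrZ a x : norm (a *: x) = `|a| * norm x.
Proof. exact: normrZ. Qed.

Let normr0_eq0 x : norm x = 0 -> x = 0.
Proof. by move=> /normr0_eq0 x0; exact: val_inj. Qed.

HB.instance Definition _ :=
  Lmodule_isNormed.Build R[i] closed_span ler_normD normrZ normr0_eq0.

Lemma closed_span_complete (F : set_system closed_span) :
  ProperFilter F -> cauchy F -> cvg F.
Proof.
move=> FF /cauchy_rnormP Fc.
have : cvg (closed_span_val @ F).
  apply/cauchy_cvgP/cauchy_rnormP => e /Fc[x Fx].
  by exists (closed_span_val x).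
move=> /cvg_ex[l /cvg_rnormP Fl].
have Cl : l \in in_closed_span.
  apply/asboolP/closure_rnormP => e e0.
  have e2 : 0 < e / 2 by rewrite divr_gt0.
  have [[x Cx] /= lx] := filter_ex (Fl _ e2).
  have /closure_rnormP/(_ _ e2)[y Sy xy] := asboolW Cx.
  exists y => //; rewrite -(subrKA x) (le_lt_trans (ler_rnormD _ _)) //.
  by rewrite [ltRHS]splitr ltrD.
by apply/cvg_ex; exists (ClosedSpan Cl); apply/fcvg_rnormP => e /Fl.
Qed.

HB.instance Definition _ := Uniform_isComplete.Build closed_span
  closed_span_complete.

End ClosedSpan.

Section CompositionOperator.
Context {R : realType} {V W X : normedModType R[i]}.

Lemma comp_is_operator (S : operator W X) (T : operator V W) :
  S \o T \in @is_operator R V X.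
Proof.
apply/asboolP; split; first by move=> a u v /=; rewrite !linearP.
move=> x; apply: continuous_comp; exact: operator_continuous.
Qed.

Definition comp_operator S T : operator V X := Operator (comp_is_operator S T).

End CompositionOperator.

Section IdentityOperator.
Context {R : realType} {V : normedModType R[i]}.

Lemma id_is_operator : id \in @is_operator R V V.
Proof. by apply/asboolP; split=> // x. Qed.

Definition id_operator : operator V V := Operator id_is_operator.

End IdentityOperator.

Section WeightedSpaces.
Context {R : realType}.
Local Notation Banach := (completeNormedModType R[i]).

Record weighted_open (E : Banach) := WeightedOpen {
  carrier :> set E;
  carrier_open : open carrier;
  weight : carrier -> R;
  weight_gt0 : forall x, 0 < weight x;
  weight_continuous : continuous weight }.

(* 'valL_0 f extends f : U -> F by 0 outside U; as U is open, differentiability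
   at the points of U does not depend on the extension. *)
Definition holomorphic (E F : Banach) (U : set E) (f : U -> F) :=
  forall x : U, differentiable ('valL_0 f : E -> F) (\val x).

Context {E : Banach} (U : weighted_open E) (F : Banach).

Definition weighted_values (f : U -> F) : set R :=
  [set weight x * rnorm (f x) | x in [set: U]].

(* sup set0 = 0, so that wnorm vanishes when U is empty *)
Definition wnorm (f : U -> F) : R := sup (weighted_values f).

Definition Hv : set (U -> F) :=
  [set f | holomorphic f /\ has_ubound (weighted_values f)].

Definition in_Hv : {pred U -> F} := [pred f | `[< Hv f >]].

Record Hv_type := HvType {
  Hv_fun :> U -> F;
  _ : Hv_fun \in in_Hv }.

HB.instance Definition _ := [isSub for Hv_fun].
HB.instance Definition _ := [Choice of Hv_type by <:].

Lemma Hv_typeP (f : Hv_type) : Hv f.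
Proof. by case: f => f fH; exact: asboolW fH. Qed.

Lemma le_wnorm (f : U -> F) x : Hv f -> weight x * rnorm (f x) <= wnorm f.
Proof.
move=> [_ ub]; apply: sup_upper_bound; last by exists x.
by split=> //; exists (weight x * rnorm (f x)), x.
Qed.

Lemma wnorm_le (f : U -> F) M : 0 <= M ->
  (forall x, weight x * rnorm (f x) <= M) -> wnorm f <= M.
Proof.
move=> M0 fM; rewrite /wnorm.
have [->|ne] := eqVneq (weighted_values f) set0; first by rewrite sup0.
by apply: ge_sup; [exact/set0P|move=> _ [x _ <-]].
Qed.

Lemma wnorm_ge0 (f : U -> F) : Hv f -> 0 <= wnorm f.
Proof.
move=> Hf; have [e|/set0P[x [y _ _]]] := eqVneq (weighted_values f) set0.
  by rewrite /wnorm e sup0.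
by rewrite (le_trans _ (le_wnorm y Hf)) // mulr_ge0 ?rnorm_ge0 // ltW ?weight_gt0.
Qed.

Let Re_ge0 (a : R[i]) : 0 <= complex.Re `|a|.
Proof. by have := normr_ge0 a; rewrite lecE => /andP[]. Qed.

Lemma in_Hv_submod : submod_closed in_Hv.
Proof.
have vD (a : R[i]) (f g : U -> F) :
    'valL_0 (a *: f + g) = a *: 'valL_0 f + 'valL_0 g :> (E -> F).
  apply/funext => x /=.
  rewrite [RHS]/(a *: 'valL_0 f x + 'valL_0 g x) /=.
  by case: ('oinv_set_val x) => [y|] //=; rewrite scaler0; exact/esym/addr0.
have v0 : 'valL_0 (0 : U -> F) = cst 0 :> (E -> F).
  by apply/funext => x /=; case: ('oinv_set_val x).
split.
  apply/asboolP; split; first by move=> x; rewrite v0; exact: differentiable_cst.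
  by exists 0 => _ [x _ <-]; rewrite [X in rnorm X](_ : _ = 0) // rnorm0 mulr0.
move=> a f g /asboolP[fh [M fM]] /asboolP[gh [N gN]]; apply/asboolP; split.
  by move=> x; rewrite vD; apply: differentiableD => //; exact: differentiableZ.
exists (complex.Re `|a| * M + N) => _ [x _ <-]; rewrite [X in rnorm X](_ : _ = a *: f x + g x) //.
have w0 := ltW (weight_gt0 x).
rewrite (@le_trans _ _ (weight x * (rnorm (a *: f x) + rnorm (g x)))) //.
  by rewrite ler_wpM2l // ler_rnormD.
rewrite mulrDr lerD ?rnormZ //; last by apply: gN; exists x.
by rewrite mulrCA ler_wpM2l //; apply: fM; exists x.
Qed.

HB.instance Definition _ := GRing.isSubmodClosed.Build _ _ in_Hv in_Hv_submod.
HB.instance Definition _ := [SubChoice_isSubLmodule of Hv_type by <:].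

Lemma wnormD (f g : Hv_type) :
  (wnorm (f + g))%:C <= (wnorm f)%:C + (wnorm g)%:C :> R[i].
Proof.
have Hf := Hv_typeP f; have Hg := Hv_typeP g.
rewrite -rmorphD lecR; apply: wnorm_le => [|x].
  by rewrite addr_ge0 // wnorm_ge0.
rewrite (@le_trans _ _ (weight x * (rnorm (f x) + rnorm (g x)))) //.
  by rewrite ler_wpM2l ?ler_rnormD // ltW ?weight_gt0.
by rewrite mulrDr lerD // le_wnorm.
Qed.

Lemma wnormZ (a : R[i]) (f : Hv_type) :
  (wnorm (a *: f))%:C = `|a| * (wnorm f)%:C :> R[i].
Proof.
have aE : `|a| = (complex.Re `|a|)%:C.
  have := normr_ge0 a; rewrite lecE.
  by case: `|a| => b c /= /andP[/eqP->].
have le b (g : Hv_type) : wnorm (b *: g) <= complex.Re `|b| * wnorm g.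
  have Hg := Hv_typeP g; apply: wnorm_le => [|x].
    by rewrite mulr_ge0 ?Re_ge0 // wnorm_ge0.
  rewrite [X in rnorm X](_ : _ = b *: g x) // rnormZ.
  by rewrite mulrCA ler_wpM2l ?Re_ge0 // le_wnorm.
rewrite aE -rmorphM; congr (_%:C); apply/eqP; rewrite eq_le le andTb.
have [a0|a0] := eqVneq a 0.
  by rewrite a0 normr0 mul0r wnorm_ge0 //; exact: Hv_typeP.
have Ra : 0 < complex.Re `|a| by rewrite -ltcR -aE normr_gt0.
rewrite mulrC -ler_pdivlMr // mulrC.
have := le a^-1 (a *: f); rewrite scalerA mulVf // scale1r normfV aE.
by rewrite -fmorphV.
Qed.

Lemma wnorm0_eq0 (f : Hv_type) : (wnorm f)%:C = 0 :> R[i] -> f = 0.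
Proof.
move=> /(@complexI R _ 0) f0; apply/val_inj/funext => x /=.
apply: rnorm0_eq0; apply/eqP; rewrite eq_le rnorm_ge0 andbT.
rewrite -(pmulr_rle0 _ (weight_gt0 x)) -f0.
exact: le_wnorm (Hv_typeP f).
Qed.

HB.instance Definition _ :=
  Lmodule_isNormed.Build R[i] Hv_type wnormD wnormZ wnorm0_eq0.

Lemma rnorm_Hv (f : Hv_type) : rnorm f = wnorm f.
Proof. by []. Qed.

End WeightedSpaces.

Section Linearization.
Context {R : realType} {E : completeNormedModType R[i]} (U : weighted_open E).

Lemma evaluation_is_operator (x : U) :
  (fun f : Hv_type U R[i] => f x) \in
  @is_operator R (Hv_type U R[i]) R[i].
Proof.
apply: (bounded_is_operator (M := (weight x)^-1)) => // f.
by rewrite ler_pdivlMl ?weight_gt0 // rnorm_Hv le_wnorm //; exact: Hv_typeP.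
Qed.

Definition evaluation (x : U) : operator (Hv_type U R[i]) R[i] :=
  Operator (evaluation_is_operator x).

Definition Gv : completeNormedModType R[i] := closed_span (range evaluation).

Lemma Delta_subproof (x : U) :
  evaluation x \in in_closed_span (range evaluation).
Proof.
apply/asboolP/subset_closure; exists 1%N, (fun=> 1), (fun=> evaluation x).
by split=> [_|]; [exists x|rewrite big_ord1 scale1r].
Qed.

Definition Delta (x : U) : Gv := ClosedSpan (Delta_subproof x).

(* The operator T_f, i.e. the unique T with T \o Delta = f, which exists for
   every f in Hv U F. *)
Definition linearization (F : completeNormedModType R[i]) (f : U -> F) :
    operator Gv F :=
  get [set T : operator Gv F | T \o Delta = f].

End Linearization.

Section Ideals.
Context {R : realType}.
Local Notation Banach := (completeNormedModType R[i]).
Local Open Scope ereal_scope.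

(* Suprema and infima defining the norms below are taken in \bar R; a normed
   class is one whose norm is finite on its members, and the value of the norm
   elsewhere is irrelevant. *)
Record is_normed_space (X : lmodType R[i]) (M : set X) (nu : X -> \bar R) :
    Prop := IsNormedSpace {
  ns_zero : M 0%R;
  ns_add : forall u v, M u -> M v -> M (u + v)%R;
  ns_scale : forall (a : R[i]) u, M u -> M (a *: u)%R;
  ns_fin_num : forall u, M u -> nu u \is a fin_num;
  ns_ge0 : forall u, M u -> 0 <= nu u;
  ns_triangle : forall u v, M u -> M v -> nu (u + v)%R <= nu u + nu v;
  ns_homogeneous : forall (a : R[i]) u, M u ->
    nu (a *: u)%R = (complex.Re `|a|)%:E * nu u;
  ns_definite : forall u, M u -> nu u = 0 -> u = 0%R }.

(* Normed operator ideals are those of Pietsch, Operator Ideals: the identity of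
   the scalar field has norm 1, and the ideal inequality holds. *)
Record operator_class := OperatorClass {
  op_mem : forall E F : Banach, set (operator E F);
  op_norm : forall E F : Banach, operator E F -> \bar R }.

Record normed_operator_ideal (A : operator_class) : Prop :=
    NormedOperatorIdeal {
  op_normed : forall E F : Banach,
    is_normed_space (@op_mem A E F) (@op_norm A E F);
  op_scalar : op_mem A (@id_operator R R[i]) /\
    op_norm A (@id_operator R R[i]) = 1;
  op_ideal : forall (E0 E F F0 : Banach)
    (S : operator F F0) (T : operator E F) (Q : operator E0 E),
    op_mem A T ->
    op_mem A (comp_operator S (comp_operator T Q)) /\
    op_norm A (comp_operator S (comp_operator T Q)) <=
      (opnorm S)%:E * op_norm A T * (opnorm Q)%:E }.

(* The components are indexed by weighted open sets (U, v), for all weights v. *)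
Record whol_class := WholClass {
  wh_mem : forall (E : Banach) (U : weighted_open E) (F : Banach),
    set (U -> F);
  wh_norm : forall (E : Banach) (U : weighted_open E) (F : Banach),
    (U -> F) -> \bar R }.

Definition is_restriction (E : Banach) (V U : weighted_open E) :=
  V `<=` U /\
  forall (x : V) (y : U), \val x = \val y -> weight x = weight y.

Definition weight_ratios (E : Banach) (V U : weighted_open E) (h : V -> U) :
    set R :=
  [set (weight x / weight (h x))%R | x in [set: V]].

Record normed_whol_ideal (I : whol_class) : Prop := NormedWholIdeal {
  wh_normed : forall (E : Banach) (U : weighted_open E) (F : Banach),
    [/\ @wh_mem I E U F `<=` @Hv R E U F,
        is_normed_space (@wh_mem I E U F) (@wh_norm I E U F) &
        forall f : U -> F, wh_mem I f -> (wnorm f)%:E <= wh_norm I f];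
  wh_rank1 : forall (E : Banach) (U : weighted_open E) (F : Banach)
    (h : U -> R[i]) (y : F), Hv h ->
    wh_mem I (fun x : U => h x *: y)%R /\
    wh_norm I (fun x : U => h x *: y)%R = (wnorm h * rnorm y)%:E;
  wh_ideal : forall (E : Banach) (V U : weighted_open E) (F G : Banach)
    (h : V -> U) (f : U -> F) (T : operator F G),
    is_restriction V U ->
    holomorphic (fun x : V => \val (h x) : E) ->
    has_ubound (weight_ratios h) ->
    wh_mem I f ->
    wh_mem I (T \o f \o h) /\
    wh_norm I (T \o f \o h) <=
      (opnorm T)%:E * wh_norm I f * (sup (weight_ratios h))%:E }.

Definition linearization_property (I : whol_class) (A : operator_class) :=
  forall (E : Banach) (U : weighted_open E) (F : Banach) (f : U -> F), Hv f ->
    (wh_mem I f <-> op_mem A (linearization f)) /\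
    (wh_mem I f -> wh_norm I f = op_norm A (linearization f)).

Definition left_quotient (A : operator_class) (I : whol_class) : whol_class :=
  WholClass
    (fun E U F => [set f : U -> F | Hv f /\
      forall (G : Banach) (T : operator F G), op_mem A T -> wh_mem I (T \o f)])
    (fun E U F (f : U -> F) => ereal_sup [set r | exists (G : Banach)
      (T : operator F G),
      [/\ op_mem A T, op_norm A T <= 1 & r = wh_norm I (T \o f)]]).

Definition composition_ideal (A : operator_class) (J : whol_class) :
    whol_class :=
  WholClass
    (fun E U F => [set f : U -> F | exists (G : Banach) (T : operator G F)
      (g : U -> G), [/\ op_mem A T, wh_mem J g & f = T \o g]])
    (fun E U F (f : U -> F) => ereal_inf [set r | exists (G : Banach)
      (T : operator G F) (g : U -> G),
      [/\ op_mem A T, wh_mem J g, f = T \o g &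
          r = op_norm A T * wh_norm J g]]).

Definition whol_class_eq (I J : whol_class) :=
  forall (E : Banach) (U : weighted_open E) (F : Banach) (f : U -> F),
    (wh_mem I f <-> wh_mem J f) /\ (wh_mem I f -> wh_norm I f = wh_norm J f).

End Ideals.

Arguments operator_class : clear implicits.
Arguments whol_class : clear implicits.

(* Main.v *)
(** Given [f] in the ideal, write [f = T_f \o Delta].  The map [Delta] lies in
    the left quotient with norm at most 1, because for [B] in [A] the linearization
    of [B \o Delta] is [B] itself; hence [f] is in the composition ideal with norm
    at most [||T_f||_A = ||f||].  The other inclusion is the definition of the
    quotient norm, applied to [A / ||A||].

    The work lies in the existence of the linearization.  The value of [T_f] at
    [g] is the vector [y] with [phi y = g (phi \o f)] for every functional
    [phi]; it is unique and depends boundedly on [g] by Hahn-Banach.  The map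
    [Delta] is holomorphic because the first-order Taylor remainders of the
    functions [f] with [||f||_v <= 1] are uniformly quadratic.  That bound
    follows from Cauchy's estimate [|h'(0)| <= 4 M / rho], applied first to
    [h(w) = f(p + w)] (so [f] is Lipschitz), then to [h(w) = f(p + w) - f(w)] (so
    [f'] is Lipschitz).  Cauchy's estimate is the mean value property of
    the difference quotient [(h(w) - h(0)) / w], and this property comes from
    Goursat's theorem on rectangles in the coordinates [w = e^s (cos t + i sin t)],
    where the sides [t = 0] and [t = 2 pi] cancel. *)

Require Import Defs.
From mathcomp Require Import all_boot all_order all_algebra complex.
From mathcomp Require Import all_classical all_reals.
From mathcomp Require Import ereal topology normedtype landau derive.
From mathcomp Require Import ring lra all_analysis.
Import Defs.

Set Implicit Arguments.
Unset Strict Implicit.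
Unset Printing Implicit Defensive.

Import Order.TTheory GRing.Theory Num.Theory.
Import numFieldNormedType.Exports.

Local Open Scope classical_set_scope.
Local Open Scope ring_scope.
Local Open Scope complex_scope.

(** * Goursat's theorem for real 1-forms *)

Section Integral.
Context {R : realType}.
Implicit Types (f F : R -> R) (a b c d e x : R).

Definition primitive_on f a b F :=
  forall x, a <= x <= b -> is_derive x 1 F (f x).

Definition continuous_on f a b := forall x, a <= x <= b -> {for x, continuous f}.

(** Clamping the argument to [[a, b]] makes [f] continuous on the whole line. Integrating from
    [a - 1] puts [a] and [b] in the interior, so the fundamental theorem of calculus gives two-sided
    derivatives at the end points too. *)
Lemma ex_primitive f a b :
  continuous_on f a b -> exists F, primitive_on f a b F.
Proof.
have [ab|ba] := leP a b; last first.
  by exists f => x /andP[ax xb]; move: (lt_le_trans ba (le_trans ax xb)); rewrite ltxx.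
move=> fc; pose c x := Num.max a (Num.min x b).
have cI x : a <= c x <= b.
  by rewrite /c le_max lexx /= ge_max ab ge_min lexx orbT.
have cK x : a <= x <= b -> c x = x.
  by move=> /andP[ax xb]; rewrite /c (min_idPl xb) (max_idPr ax).
have cc : continuous c.
  move=> x; apply: (@continuous_max _ _ (cst a) (id \min cst b)).
    exact: cst_continuous.
  by apply: continuous_min; [exact: cvg_id|exact: cst_continuous].
have gc : continuous (f \o c).
  by move=> x; apply: continuous_comp; [exact: cc|exact/fc/cI].
exists (fun x => \int[lebesgue_measure]_(t in [set` `[a - 1, x]]) (f \o c) t) => x ax.
have xb : x < b + 1 by lra.
have [//| |||h1 h2] := @continuous_FTC1_closed R (f \o c) (a - 1) x (b + 1).
- apply: continuous_compact_integrable; first exact: segment_compact.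
  exact: continuous_subspaceT.
- by lra.
- exact: gc.
apply: DeriveDef => //.
by rewrite -derive1E h2 /= cK.
Qed.

(** The mean value theorem for [F] minus a primitive of [c + d * x]. *)
Lemma primitive_affine_bound f a b F c d e : a <= b -> primitive_on f a b F ->
  (forall x, a <= x <= b -> `|f x - (c + d * x)| <= e) ->
  `|F b - F a - (c * (b - a) + d * (b ^+ 2 - a ^+ 2) / 2)| <= e * (b - a).
Proof.
move=> ab Ff fe; pose G x := F x - (c * x + d / 2 * x ^+ 2).
have dG x : a <= x <= b -> is_derive x 1 G (f x - (c + d * x)).
  move=> /Ff Fx; apply: is_derive_eq; rewrite /GRing.scale /=. lra.
have dGoo x : x \in `]a, b[ -> is_derive x 1 G (f x - (c + d * x)).
  by rewrite in_itv /= => /andP[ax xb]; apply: dG; rewrite !ltW.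
have Gc : {within `[a, b], continuous G}.
  by apply: derivable_within_continuous => x; rewrite in_itv /= => /dG[].
have [z zab GE] := MVT_segment ab dGoo Gc.
have -> : F b - F a - (c * (b - a) + d * (b ^+ 2 - a ^+ 2) / 2) = G b - G a.
  by rewrite /G; lra.
rewrite GE normrM (ger0_norm (_ : 0 <= b - a)) ?subr_ge0 //.
by rewrite ler_wpM2r ?subr_ge0 // fe //; move: zab; rewrite in_itv.
Qed.

(* The integral of [f] over [[a, b]], meaningful when [a <= b] and [f] is
   continuous at each point of [[a, b]]. *)
Definition integ f a b : R :=
  get [set r | exists2 F, primitive_on f a b F & r = F b - F a].

(** Two primitives differ by a constant, by [primitive_affine_bound] with all constants 0, so the
    primitive picked by [get] does not matter. *)
Lemma integE f a b F : a <= b -> primitive_on f a b F ->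
  integ f a b = F b - F a.
Proof.
move=> ab Ff.
have [G Gf ->] : exists2 G, primitive_on f a b G & integ f a b = G b - G a.
  by apply: (@getPex _ [set r | exists2 G, _ & r = _]); exists (F b - F a), F.
have GF : primitive_on (fun=> 0) a b (G - F).
  move=> x xab; have dG := Gf x xab; have dF := Ff x xab.
  by apply: is_derive_eq; rewrite subrr.
have := @primitive_affine_bound _ _ _ _ 0 0 0 ab GF.
rewrite !mul0r addr0 subr0 normr_le0 !fctE => h.
suff /eqP : G b - F b - (G a - F a) == 0 by lra.
by apply: h => x _; rewrite !mul0r addr0 subr0 normr0.
Qed.

Lemma integ_affine_bound f a b c d e : a <= b -> continuous_on f a b ->
  (forall x, a <= x <= b -> `|f x - (c + d * x)| <= e) ->
  `|integ f a b - (c * (b - a) + d * (b ^+ 2 - a ^+ 2) / 2)| <= e * (b - a).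
Proof.
move=> ab /ex_primitive[F Ff] fe; rewrite (integE ab Ff).
exact: primitive_affine_bound Ff fe.
Qed.

Lemma integ_bound f a b c e : a <= b -> continuous_on f a b ->
  (forall x, a <= x <= b -> `|f x - c| <= e) ->
  `|integ f a b - c * (b - a)| <= e * (b - a).
Proof.
move=> ab fc fe; have := @integ_affine_bound f a b c 0 e ab fc.
rewrite !mul0r addr0; apply => x xab; rewrite mul0r addr0; exact: fe.
Qed.

Lemma integ_split f a m b : a <= m -> m <= b -> continuous_on f a b ->
  integ f a b = integ f a m + integ f m b.
Proof.
move=> am mb /ex_primitive[F Ff]; rewrite (integE (le_trans am mb) Ff).
rewrite (@integE f a m F) //; last first.
  by move=> x /andP[ax xm]; apply: Ff; rewrite ax (le_trans xm).
rewrite (@integE f m b F) //; last first.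
  by move=> x /andP[ax xm]; apply: Ff; rewrite xm (le_trans am).
lra.
Qed.

End Integral.

(** * Circulation around rectangles and bisection *)

Section Goursat.
Context {R : realType}.
Implicit Types (P Q : R -> R -> R) (s t u v : R).

(* The 1-form P ds + Q dt is differentiable and closed at (s, t). *)
Definition closed_at P Q s t := exists p q c : R,
  forall e : R, 0 < e -> exists2 d : R, 0 < d & forall u v,
    `|u - s| < d -> `|v - t| < d ->
    `|P u v - (P s t + p * (u - s) + c * (v - t))| <= e * (`|u - s| + `|v - t|) /\
    `|Q u v - (Q s t + c * (u - s) + q * (v - t))| <= e * (`|u - s| + `|v - t|).

(** The counterclockwise line integral of P ds + Q dt along the boundary of the rectangle with lower
    left corner [(s, t)], width [w] and height [h]. *)
Definition circulation P Q s t w h :=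
  integ (P^~ t) s (s + w) + integ (Q (s + w)) t (t + h)
  - integ (P^~ (t + h)) s (s + w) - integ (Q s) t (t + h).

Section continuity.
Variables (P Q : R -> R -> R) (s0 t0 w0 h0 : R).
Hypothesis PQ : forall s t, s0 <= s <= s0 + w0 -> t0 <= t <= t0 + h0 ->
  closed_at P Q s t.

Let lin_cont (f : R -> R) x (k : R) :
  (exists2 d : R, 0 < d & forall y, `|y - x| < d -> `|f y - f x| <= k * `|y - x|) ->
  {for x, continuous f}.
Proof.
move=> [d d0 fd]; apply/cvgrPdist_le => e e0.
have k1 : 0 < `|k| + 1 by rewrite ltr_wpDl.
near=> y; rewrite distrC (@le_trans _ _ (k * `|y - x|)) //.
  by apply: fd; rewrite distrC; near: y; exact: cvgr_dist_lt.
rewrite (@le_trans _ _ ((`|k| + 1) * `|y - x|)) //.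
  by rewrite ler_wpM2r // (le_trans (ler_norm k)) // lerDl.
rewrite mulrC -ler_pdivlMr // distrC.
by near: y; apply: cvgr_dist_le; rewrite // divr_gt0.
Unshelve. all: by end_near. Qed.

Lemma closed_continuous s t : closed_at P Q s t ->
  {for s, continuous (P^~ t)} /\ {for t, continuous (Q s)}.
Proof.
move=> [p [q [c /(_ 1 ltr01)[d d0 PQd]]]]; split.
  apply: (lin_cont (k := `|p| + 1)); exists d => // u us.
  have [|h _] := PQd u t us; first by rewrite subrr normr0.
  move: h; rewrite subrr mulr0 normr0 !addr0 mul1r opprD addrA => h.
  rewrite -(subrK (p * (u - s)) (P u t - P s t)).
  by rewrite (le_trans (ler_normD _ _)) // normrM mulrDl mul1r addrC lerD.
apply: (lin_cont (k := `|q| + 1)); exists d => // u us.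
have [|_ h] := PQd s u _ us; first by rewrite subrr normr0.
move: h; rewrite subrr mulr0 normr0 addr0 add0r mul1r opprD addrA => h.
rewrite -(subrK (q * (u - t)) (Q s u - Q s t)).
by rewrite (le_trans (ler_normD _ _)) // normrM mulrDl mul1r addrC lerD.
Qed.

(** The integrals along the inner sides of the four quarters cancel; those along the outer sides add
    up by [integ_split]. *)
Lemma circulation_split s t w h : 0 <= w -> 0 <= h ->
  s0 <= s -> s + w + w <= s0 + w0 -> t0 <= t -> t + h + h <= t0 + h0 ->
  circulation P Q s t (w + w) (h + h) =
  circulation P Q s t w h + circulation P Q (s + w) t w h +
  (circulation P Q s (t + h) w h + circulation P Q (s + w) (t + h) w h).
Proof.
move=> w_ge0 h_ge0 s_ge s_le t_ge t_le.
have Pc v : t0 <= v <= t0 + h0 -> continuous_on (P^~ v) s (s + w + w).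
  move=> vI x xI; have [|//] := @closed_continuous x v _.
  by apply: PQ => //; lra.
have Qc u : s0 <= u <= s0 + w0 -> continuous_on (Q u) t (t + h + h).
  move=> uI x xI; have [|//] := @closed_continuous u x _.
  by apply: PQ => //; lra.
have Ps v : t0 <= v <= t0 + h0 ->
    integ (P^~ v) s (s + w + w) =
    integ (P^~ v) s (s + w) + integ (P^~ v) (s + w) (s + w + w).
  by move=> vI; apply: integ_split; [lra|lra|exact: Pc].
have Qs u : s0 <= u <= s0 + w0 ->
    integ (Q u) t (t + h + h) =
    integ (Q u) t (t + h) + integ (Q u) (t + h) (t + h + h).
  by move=> uI; apply: integ_split; [lra|lra|exact: Qc].
rewrite /circulation !addrA Ps ?Ps ?Qs; try lra.
Qed.

End continuity.

(** Up to an error [n] the form is affine with equal cross coefficients [c], and such an affine form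
    has circulation 0. The error contributes at most [n] times the perimeter, which is
    [e * (w + h) ^+ 2]. *)
Lemma circulation_local P Q s t : closed_at P Q s t ->
  forall e : R, 0 < e -> exists2 d : R, 0 < d & forall u v w h,
    0 <= w < d -> 0 <= h < d -> u <= s <= u + w -> v <= t <= v + h ->
    (forall s t, u <= s <= u + w -> v <= t <= v + h -> closed_at P Q s t) ->
    `|circulation P Q u v w h| <= e * (w + h) ^+ 2.
Proof.
move=> [p [q [c H]]] e e0; have e2 : 0 < e / 2 by lra.
have [d d0 Hd] := H _ e2; exists d => // u v w h wd hd sI tI PQ.
pose n := e / 2 * (w + h).
have Hn x y : u <= x <= u + w -> v <= y <= v + h ->
    `|P x y - (P s t + p * (x - s) + c * (y - t))| <= n /\
    `|Q x y - (Q s t + c * (x - s) + q * (y - t))| <= n.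
  move=> xI yI.
  have xs : `|x - s| <= w by rewrite ler_norml; lra.
  have yt : `|y - t| <= h by rewrite ler_norml; lra.
  have le_n : e / 2 * (`|x - s| + `|y - t|) <= n by rewrite ler_wpM2l ?lerD // ltW.
  move: wd hd => /andP[_ wd] /andP[_ hd].
  have [h1 h2] := Hd x y (le_lt_trans xs wd) (le_lt_trans yt hd).
  by rewrite (le_trans h1) // (le_trans h2).
have Pb y : v <= y <= v + h ->
    `|integ (P^~ y) u (u + w) - ((P s t - p * s + c * (y - t)) * (u + w - u) +
       p * ((u + w) ^+ 2 - u ^+ 2) / 2)| <= n * (u + w - u).
  move=> yI; apply: integ_affine_bound; first lra.
    by move=> x xI; have [] := closed_continuous (PQ x y xI yI).
  move=> x xI; have [H1 _] := Hn x y xI yI; move: H1; congr (`|_| <= _); ring.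
have Qb x : u <= x <= u + w ->
    `|integ (Q x) v (v + h) - ((Q s t - q * t + c * (x - s)) * (v + h - v) +
       q * ((v + h) ^+ 2 - v ^+ 2) / 2)| <= n * (v + h - v).
  move=> xI; apply: integ_affine_bound; first lra.
    by move=> y yI; have [] := closed_continuous (PQ x y xI yI).
  move=> y yI; have [_ H1] := Hn x y xI yI; move: H1; congr (`|_| <= _); ring.
have := Pb v ltac:(lra); have := Pb (v + h) ltac:(lra).
have := Qb u ltac:(lra); have := Qb (u + w) ltac:(lra).
have -> : e * (w + h) ^+ 2 = 2 * (n * w) + 2 * (n * h) by rewrite /n; field.
rewrite /circulation !(addrAC _ w) !(addrAC _ h) !subrr !add0r.
set i1 := integ _ _ _; set i2 := integ _ _ _; set i3 := integ _ _ _.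
set i4 := integ _ _ _.
rewrite !ler_norml; nra.
Qed.

(** A circulation larger than [k] times the area passes to one of the four quarters. The nested
    rectangles shrink to a point, where [circulation_local] gives a contradiction. *)
Lemma goursat P Q s t w h : 0 < w -> 0 < h ->
  (forall u v, s <= u <= s + w -> t <= v <= t + h -> closed_at P Q u v) ->
  circulation P Q s t w h = 0.
Proof.
move=> w0 h0 PQ; apply/eqP; rewrite -normr_le0; apply/ler_addgt0Pr => e e0; rewrite add0r.
pose k := e / (w * h); have wh0 : 0 < w * h by rewrite mulr_gt0.
have k0 : 0 < k by rewrite divr_gt0.
rewrite leNgt; apply/negP => big.
pose wn n := w / 2 ^+ n; pose hn n := h / 2 ^+ n.
have wnS n : wn n = wn n.+1 + wn n.+1 by rewrite /wn exprS; field; rewrite expf_neq0.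
have hnS n : hn n = hn n.+1 + hn n.+1 by rewrite /hn exprS; field; rewrite expf_neq0.
have wn0 n : 0 < wn n by rewrite divr_gt0 // exprn_gt0.
have hn0 n : 0 < hn n by rewrite divr_gt0 // exprn_gt0.
pose inside n (p : R * R) :=
  [/\ s <= p.1, p.1 + wn n <= s + w, t <= p.2 & p.2 + hn n <= t + h].
pose bad n (p : R * R) := inside n p /\
  k * (wn n * hn n) < `|circulation P Q p.1 p.2 (wn n) (hn n)|.
pose next n (p q : R * R) :=
  [/\ p.1 <= q.1, q.1 + wn n.+1 <= p.1 + wn n, p.2 <= q.2 &
      q.2 + hn n.+1 <= p.2 + hn n].
(* Badness of the given rectangle is a premise under the existential, so that [choice] yields a
   total function. *)
have step (np : nat * (R * R)) : exists q, bad np.1 np.2 ->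
    bad np.1.+1 q /\ next np.1 np.2 q.
  case: np => n [u v] /=; have [bp|nbp] := pselect (bad n (u, v)); last first.
    by exists (u, v).
  case: (bp) => -[/= su us tv vt]; rewrite wnS hnS.
  have := wn0 n.+1; have := hn0 n.+1; move: (wnS n) (hnS n).
  set w' := wn n.+1; set h' := hn n.+1 => wE hE h'0 w'0.
  rewrite (circulation_split PQ); try lra.
  set c1 := circulation _ _ _ _ _ _; set c2 := circulation _ _ _ _ _ _.
  set c3 := circulation _ _ _ _ _ _; set c4 := circulation _ _ _ _ _ _ => lt.
  (* [(a, b)] is the offset of the chosen quarter. *)
  have sub a b : 0 <= a <= w' -> 0 <= b <= h' ->
      k * (w' * h') < `|circulation P Q (u + a) (v + b) w' h'| ->
      exists q, bad n (u, v) -> bad n.+1 q /\ next n (u, v) q.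
    move=> aE bE big'; exists (u + a, v + b) => _.
    by clear - su us tv vt aE bE w'0 h'0 wE hE big'; split; [split=> //|];
      split; rewrite /= -/w' -/h'; lra.
  have [l1|l1] := ltP (k * (w' * h')) `|c1|.
    by apply: (sub 0 0); rewrite ?addr0 ?lexx ?ltW.
  have [l2|l2] := ltP (k * (w' * h')) `|c2|.
    by apply: (sub w' 0); rewrite ?addr0 ?lexx ?ltW.
  have [l3|l3] := ltP (k * (w' * h')) `|c3|.
    by apply: (sub 0 h'); rewrite ?addr0 ?lexx ?ltW.
  have [l4|l4] := ltP (k * (w' * h')) `|c4|.
    by apply: (sub w' h'); rewrite ?lexx ?ltW.
  suff : `|c1 + c2 + (c3 + c4)| <= k * ((w' + w') * (h' + h')) by rewrite leNgt lt.
  rewrite (le_trans (ler_normD _ _)) // (_ : k * _ = k * (w' * h') + k * (w' * h') +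
    (k * (w' * h') + k * (w' * h'))); last by ring.
  by rewrite lerD // (le_trans (ler_normD _ _)) // lerD.
have [f fE] := choice step.
pose p := fix p n := if n is m.+1 then f (m, p m) else (s, t).
have badp n : bad n (p n).
  elim: n => [|n /(fE (n, p n))[]//]; split.
    by rewrite /inside /wn /hn expr0 !divr1 !lexx.
  by rewrite /wn /hn expr0 !divr1 /k mulfVK // gt_eqF.
have nextp n : next n (p n) (p n.+1) by have [] := fE (n, p n) (badp n).
have mono m n : (m <= n)%N -> [/\ (p m).1 <= (p n).1, (p n).1 + wn n <= (p m).1 + wn m,
    (p m).2 <= (p n).2 & (p n).2 + hn n <= (p m).2 + hn m].
  elim: n => [|n IH]; first by rewrite leqn0 => /eqP->.
  rewrite leq_eqVlt => /predU1P[->//|/IH[a1 a2 a3 a4]].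
  have [b1 b2 b3 b4] := nextp n; split; lra.
pose sup1 := sup (range (fun n => (p n).1)).
pose sup2 := sup (range (fun n => (p n).2)).
(* The lower left corner of one rectangle never exceeds the upper right corner of another, so the
   suprema of the corners give a point of all rectangles. *)
have le12 m n : (p m).1 <= (p n).1 + wn n /\ (p m).2 <= (p n).2 + hn n.
  have [mn|/ltnW nm] := leqP m n.
    have [a1 a2 a3 a4] := mono m n mn; have := wn0 n; have := hn0 n; lra.
  have [a1 a2 a3 a4] := mono n m nm; have := wn0 m; have := hn0 m; lra.
have in1 n : (p n).1 <= sup1 <= (p n).1 + wn n.
  apply/andP; split.
    apply: ub_le_sup; last by exists n.
    by exists ((p 0).1 + wn 0) => _ [m _ <-]; have [] := le12 m 0.
  apply: ge_sup; first by exists (p 0).1, 0.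
  by move=> _ [m _ <-]; have [] := le12 m n.
have in2 n : (p n).2 <= sup2 <= (p n).2 + hn n.
  apply/andP; split.
    apply: ub_le_sup; last by exists n.
    by exists ((p 0).2 + hn 0) => _ [m _ <-]; have [] := le12 m 0.
  apply: ge_sup; first by exists (p 0).2, 0.
  by move=> _ [m _ <-]; have [] := le12 m n.
have [[a1 a2 a3 a4] _] := badp 0.
have PQ0 : closed_at P Q sup1 sup2.
  by apply: PQ; [have := in1 0|have := in2 0]; rewrite /wn /hn expr0 !divr1 /=.
(* All rectangles have the proportions of the first, so this constant times [(wn n + hn n) ^+ 2] is
   exactly [k * (wn n * hn n)]. *)
have e'0 : 0 < k * (w * h) / (w + h) ^+ 2.
  by apply: divr_gt0; [exact: mulr_gt0|apply: exprn_gt0; exact: addr_gt0].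
have [d d0 Hd] := circulation_local PQ0 e'0.
have [n wd hd] : exists2 n, wn n < d & hn n < d.
  have [n nd] : exists n, (w + h) / 2 ^+ n < d.
    exists (Num.truncn ((w + h) / d)).+1.
    rewrite ltr_pdivrMr ?exprn_gt0 // mulrC -ltr_pdivrMr //.
    by rewrite (lt_trans (truncnS_gt _)) // -natrX ltr_nat ltn_expl.
  have pn : 0 < (2 ^+ n : R)^-1 by rewrite invr_gt0 exprn_gt0.
  by exists n; apply: le_lt_trans nd; rewrite ler_wpM2r ?(ltW pn) //; lra.
have [[b1 b2 b3 b4]] := badp n.
apply/negP; rewrite -leNgt (le_trans (Hd _ _ _ _ _ _ (in1 n) (in2 n) _)) //.
- by rewrite ltW ?wn0.
- by rewrite ltW ?hn0.
- by move=> x y xI yI; apply: PQ; lra.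
rewrite le_eqVlt; apply/orP; left; apply/eqP; rewrite /wn /hn; field.
by rewrite ?expf_neq0 //= gt_eqF // addr_gt0.
Qed.

End Goursat.

(** * Complex differentiability and the Cauchy estimates *)

Section ComplexNorm.
Context {R : realType}.
Implicit Types z w : R[i].

Lemma rnormM z w : rnorm (z * w) = rnorm z * rnorm w.
Proof. exact: rnormZ. Qed.

Lemma rnorm_real (x : R) : rnorm x%:C = `|x|.
Proof. by rewrite /rnorm normc_def /= expr0n addr0 sqrtr_sqr. Qed.

Lemma rnormi : rnorm ('i : R[i]) = 1.
Proof. by rewrite /rnorm normc_def /= expr0n expr1n add0r sqrtr1. Qed.

Lemma normr_Re_le z : `|complex.Re z| <= rnorm z.
Proof. by rewrite -lecR -rnormE normc_ge_Re. Qed.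

(** Transfers estimates from real to imaginary parts, since multiplication by [- 'i] keeps the
    modulus. *)
Lemma Im_mulNi z : complex.Im z = complex.Re (- 'i * z).
Proof. by case: z => a b /=; ring. Qed.

Lemma normr_Im_le z : `|complex.Im z| <= rnorm z.
Proof. by rewrite Im_mulNi (le_trans (normr_Re_le _)) // rnormM rnormN rnormi mul1r. Qed.

Lemma rnorm_le_ReIm z : rnorm z <= `|complex.Re z| + `|complex.Im z|.
Proof.
case: z => a b; rewrite [X in rnorm X](_ : _ = a%:C + 'i * b%:C) /=; last first.
  by apply/eqP; rewrite eq_complex /=; apply/andP; split; apply/eqP; ring.
by rewrite (le_trans (ler_rnormD _ _)) // rnormM rnormi mul1r !rnorm_real.
Qed.

Lemma cvg_complex T (F : set_system T) {FF : Filter F} (f g : T -> R) (a b : R) :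
  f @ F --> a -> g @ F --> b -> (fun x => f x +i* g x) @ F --> a +i* b.
Proof.
move=> /cvgrPdist_lt fa /cvgrPdist_lt gb; apply/cvg_rnormP => e e0.
have e2 : 0 < e / 2 by lra.
apply: filterS2 (fa _ e2) (gb _ e2) => x /= xa xb.
by rewrite (le_lt_trans (rnorm_le_ReIm _)) //= [ltRHS]splitr ltrD.
Qed.

Lemma cvg_Re T (F : set_system T) {FF : Filter F} (f : T -> R[i]) z :
  f @ F --> z -> (fun x => complex.Re (f x)) @ F --> complex.Re z.
Proof.
move=> /cvg_rnormP fz; apply/cvgrPdist_lt => e /fz; apply: filterS => x /=.
by rewrite -raddfB; apply: le_lt_trans; exact: normr_Re_le.
Qed.

Section cvg.
Context {T : Type} {F : set_system T} {FF : Filter F}.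
Implicit Types (f g : T -> R[i]).

(* The library lemmas specialized to the topology that R[i] has here, which
   unification does not find by itself. *)
Lemma ccvg_cst z : (fun=> z) @ F --> z.
Proof. exact: cvg_cst. Qed.

Lemma ccvgD f g z w : f @ F --> z -> g @ F --> w -> (fun x => f x + g x) @ F --> z + w.
Proof. by move=> fz gw; exact: (cvgD fz gw). Qed.

Lemma ccvgB f g z w : f @ F --> z -> g @ F --> w -> (fun x => f x - g x) @ F --> z - w.
Proof. by move=> fz gw; exact: (cvgB fz gw). Qed.

Lemma ccvgM f g z w : f @ F --> z -> g @ F --> w -> (fun x => f x * g x) @ F --> z * w.
Proof. by move=> fz gw; exact: (cvgM fz gw). Qed.

Lemma ccvgV f z : z != 0 -> f @ F --> z -> (fun x => (f x)^-1) @ F --> z^-1.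
Proof. by move=> z0 fz; exact: (cvgV z0 fz). Qed.

End cvg.

Lemma rnorm_gt0 (V : normedModType R[i]) (x : V) : x != 0 -> 0 < rnorm x.
Proof.
by move=> x0; rewrite lt_def rnorm_ge0 andbT; apply: contra_neq x0 => /rnorm0_eq0.
Qed.

Lemma nbhs_rnormP (V : normedModType R[i]) (x : V) (A : set V) :
  nbhs x A <-> exists2 e : R, 0 < e & forall y, rnorm (x - y) < e -> A y.
Proof.
split=> [/nbhs_ballP[e /= e0 eA]|[e e0 eA]].
  have eE : e = (complex.Re e)%:C.
    by move: e0; rewrite ltcE; case: (e) => a b /= /andP[/eqP->].
  exists (complex.Re e); first by rewrite -ltcR -eE.
  by move=> y xy; apply: eA; rewrite -ball_normE /ball_ /= rnormE eE ltcR.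
have : nbhs x [set y | rnorm (x - y) < e].
  by have /fcvg_rnormP := @cvg_refl _ (nbhs x); apply.
exact: filterS.
Qed.

End ComplexNorm.

(** * Rules for complex derivatives *)

Section ComplexDerivative.
Context {R : realType}.
Implicit Types (f g : R[i] -> R[i]) (a b c d e z w : R[i]).

(* Caratheodory's form of complex differentiability. *)
Definition cderiv f z d := exists phi : R[i] -> R[i],
  [/\ \forall w \near z, f w - f z = phi w * (w - z),
      {for z, continuous phi} & phi z = d].

Lemma cderivB f g z d e :
  cderiv f z d -> cderiv g z e -> cderiv (fun w => f w - g w) z (d - e).
Proof.
move=> [p [pE pc <-]] [q [qE qc <-]]; exists (fun w => p w - q w); split; last by [].
  apply: filterS2 pE qE => w; rewrite mulrBl => <- <-; ring.
exact: (ccvgB pc qc).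
Qed.

Lemma cderivZ f z d c : cderiv f z d -> cderiv (fun w => c * f w) z (c * d).
Proof.
move=> [p [pE pc <-]]; exists (fun w => c * p w); split; last by [].
  apply: filterS pE => w wE; rewrite -mulrBr -mulrA wE; exact: erefl.
apply: (ccvgM (F := nbhs z)); [exact: (ccvg_cst (F := nbhs z))|exact: pc].
Qed.

Lemma cderiv_id z : cderiv id z 1.
Proof.
exists (fun=> 1); split; [|exact: (ccvg_cst (F := nbhs z))|by []].
apply: filterE => w; rewrite mul1r; exact: erefl.
Qed.

Lemma cderiv_affine f a b z d :
  cderiv f (a + b * z) d -> cderiv (fun w => f (a + b * w)) z (b * d).
Proof.
have c : {for z, continuous (fun w => a + b * w)}.
  apply: (ccvgD (F := nbhs z)); first exact: (ccvg_cst (F := nbhs z)).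
  apply: (ccvgM (F := nbhs z)); last exact: (@cvg_id _ (nbhs z)).
  exact: (ccvg_cst (F := nbhs z)).
move=> [p [pE pc <-]]; exists (fun w => b * p (a + b * w)); split; last by [].
  apply: (@filterS _ (nbhs z) _ _ _ _ (c _ pE)) => w /= ->; ring.
apply: (ccvgM (F := nbhs z)); first exact: (ccvg_cst (F := nbhs z)).
exact: (continuous_comp c).
Qed.

Lemma cderiv_quotient f (phi : R[i] -> R[i]) z d :
  (forall w, f w - f 0 = phi w * w) -> z != 0 -> cderiv f z d ->
  exists e, cderiv phi z e.
Proof.
move=> phiE z0 [p [pE pc pz]].
exists ((p z * z - (f z - f 0)) / (z * z)).
(* The slope of [phi] between [z] and [w]: once [f w - f z] is written as [p w * (w - z)], the
   factor [w - z] cancels. *)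
exists (fun w => (p w * z - (f z - f 0)) / (w * z)); split; last by [].
  have nz : \forall w \near z, w != 0.
    apply/nbhs_rnormP; exists (rnorm z).
      by exact: rnorm_gt0.
    by move=> w; apply: contraTneq => ->; rewrite subr0 ltxx.
  apply: filterS2 pE nz => w wE w0.
  have -> : phi w = (f w - f 0) / w by rewrite phiE mulfK.
  have -> : phi z = (f z - f 0) / z by rewrite phiE mulfK.
  have -> : f w = f z + p w * (w - z) by rewrite -wE addrC subrK.
  by field; rewrite w0 z0.
apply: (ccvgM (F := nbhs z)).
  apply: (ccvgB (F := nbhs z)); last exact: (ccvg_cst (F := nbhs z)).
  apply: (ccvgM (F := nbhs z)); [exact: pc|exact: (ccvg_cst (F := nbhs z))].
apply: (ccvgV (F := nbhs z)); first by rewrite mulf_neq0.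
apply: (ccvgM (F := nbhs z)); first exact: (@cvg_id _ (nbhs z)).
exact: (ccvg_cst (F := nbhs z)).
Qed.

End ComplexDerivative.

(** * Holomorphic functions in polar coordinates *)

Section PolarCoordinates.
Context {R : realType}.
Implicit Types (s t u v : R).

Definition cis t : R[i] := cos t +i* sin t.
Definition polar s t : R[i] := (expR s)%:C * cis t.

Lemma rnorm_cis t : rnorm (cis t) = 1.
Proof. by rewrite /rnorm normc_def /= cos2Dsin2 sqrtr1. Qed.

Lemma rnorm_polar s t : rnorm (polar s t) = expR s.
Proof. by rewrite rnormM rnorm_cis mulr1 rnorm_real ger0_norm // expR_ge0. Qed.

Lemma polarDpi2 s : polar s (0 + pi *+ 2) = polar s 0.
Proof. by rewrite add0r /polar /cis cos2pi sin2pi cos0 sin0. Qed.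

(** With [w = polar s t] one has dw / w = ds + i dt, so this form is the imaginary part of K dw / w.
    If [g] is the derivative of [K (polar s t)] in [s], the one in [t] is ['i * g], and both cross
    derivatives equal the real part of [g]. *)
Lemma closed_at_polar (K : R[i] -> R[i]) s t d : cderiv K (polar s t) d ->
  closed_at (fun s t => complex.Im (K (polar s t)))
            (fun s t => complex.Re (K (polar s t))) s t.
Proof.
move=> [phi [phiE phic phiz]].
have [a [aE ac as_]] := (is_derive1_caratheodory expR s (expR s)).1 (is_derive_expR s).
have [b [bE bc bt]] := (is_derive1_caratheodory cos t (- sin t)).1 (is_derive_cos t).
have [c [cE cc ct]] := (is_derive1_caratheodory sin t (cos t)).1 (is_derive_sin t).
have polc : (fun p : R * R => polar p.1 p.2) @ (s, t) --> polar s t.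
  apply: (ccvgM (F := nbhs (s, t))).
    apply: (cvg_complex (F := nbhs (s, t))); last exact: cvg_cst.
    by apply: continuous_cvg; [exact: continuous_expR|exact: cvg_fst].
  apply: (cvg_complex (F := nbhs (s, t))).
    by apply: continuous_cvg; [exact: continuous_cos|exact: cvg_snd].
  by apply: continuous_cvg; [exact: continuous_sin|exact: cvg_snd].
(* [A] comes from changing the radius at the new angle, [B] from changing the angle at the old
   radius [expR s]. *)
pose A (p : R * R) := phi (polar p.1 p.2) * ((a p.1)%:C * cis p.2).
pose B (p : R * R) := phi (polar p.1 p.2) * ((expR s)%:C * (b p.2 +i* c p.2)).
pose g := d * polar s t.
have Ac : A @ (s, t) --> g.
  rewrite /g -phiz; apply: (ccvgM (F := nbhs (s, t))); first exact: (cvg_comp _ _ polc phic).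
  apply: (ccvgM (F := nbhs (s, t))).
    apply: (cvg_complex (F := nbhs (s, t))); last exact: cvg_cst.
    by rewrite -as_; apply: continuous_cvg => //; exact: cvg_fst.
  apply: (cvg_complex (F := nbhs (s, t))).
    by apply: continuous_cvg; [exact: continuous_cos|exact: cvg_snd].
  by apply: continuous_cvg; [exact: continuous_sin|exact: cvg_snd].
have Bc : B @ (s, t) --> 'i * g.
  rewrite (_ : 'i * g = d * ((expR s)%:C * (- sin t +i* cos t))); last first.
    rewrite /g /polar /cis mulrCA; congr (_ * _); rewrite mulrCA; congr (_ * _).
    by apply/eqP; rewrite eq_complex /=; apply/andP; split; apply/eqP; ring.
  rewrite -phiz; apply: (ccvgM (F := nbhs (s, t))); first exact: (cvg_comp _ _ polc phic).
  apply: (ccvgM (F := nbhs (s, t))); first exact: (ccvg_cst (F := nbhs (s, t))).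
  apply: (cvg_complex (F := nbhs (s, t))).
    by rewrite -bt; apply: continuous_cvg => //; exact: cvg_snd.
  by rewrite -ct; apply: continuous_cvg => //; exact: cvg_snd.
have Kd : \forall p \near (s, t), K (polar p.1 p.2) - K (polar s t) =
    A p * (p.1 - s)%:C + B p * (p.2 - t)%:C.
  apply: (@filterS _ (nbhs (s, t)) _ _ _ _ (polc _ phiE)) => -[u v] /= ->.
  rewrite /A /B /= -!mulrA -mulrDr; congr (_ * _).
  rewrite /polar; apply/eqP; rewrite eq_complex /=; apply/andP; split; apply/eqP.
    have -> : expR u = expR s + a u * (u - s) by rewrite -aE addrC subrK.
    have -> : cos t = cos v - b v * (v - t) by rewrite -bE opprB addrC subrK.
    by ring.
  have -> : expR u = expR s + a u * (u - s) by rewrite -aE addrC subrK.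
  have -> : sin t = sin v - c v * (v - t) by rewrite -cE opprB addrC subrK.
  by ring.
exists (complex.Im g), (complex.Re ('i * g)), (complex.Re g) => e e0.
move/cvg_rnormP : Ac => /(_ _ e0) Ae; move/cvg_rnormP : Bc => /(_ _ e0) Be.
have [[X Y] [/= /nbhs_ballP[r1 /= r10 r1X] /nbhs_ballP[r2 /= r20 r2Y]] XY] :=
  filterI Kd (filterI Ae Be).
exists (Num.min r1 r2); first by rewrite lt_min r10.
move=> u v; rewrite !lt_min => /andP[us _] /andP[_ vt].
have [|Kuv [/= Auv Buv]] := XY (u, v).
  by split; [apply: r1X|apply: r2Y]; rewrite /= /ball /= distrC.
have main : rnorm (K (polar u v) - (K (polar s t) + g * (u - s)%:C + 'i * g * (v - t)%:C))
    <= e * (`|u - s| + `|v - t|).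
  rewrite (_ : _ - _ = - ((g - A (u, v)) * (u - s)%:C + ('i * g - B (u, v)) * (v - t)%:C)).
    rewrite rnormN (le_trans (ler_rnormD _ _)) // mulrDr !rnormM !rnorm_real.
    by rewrite lerD // ler_wpM2r // ltW.
  by rewrite -(subrK (K (polar s t)) (K (polar u v))) Kuv /=; ring.
split.
  apply: le_trans main; apply: le_trans (normr_Im_le _).
  rewrite le_eqVlt; apply/orP; left; apply/eqP; congr (`|_|).
  rewrite !raddfB !raddfD /=; case: (g) => g1 g2 /=; ring.
apply: le_trans main; apply: le_trans (normr_Re_le _).
rewrite le_eqVlt; apply/orP; left; apply/eqP; congr (`|_|).
rewrite !raddfB !raddfD /=; case: (g) => g1 g2 /=; ring.
Qed.

End PolarCoordinates.

(** * Cauchy's estimate and the quadratic Taylor bound *)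

Section CauchyEstimate.
Context {R : realType}.
Implicit Types (f g K d phi : R[i] -> R[i]) (w z p q : R[i]) (r rho M L B : R).

(** By Goursat's theorem the integral of the real part over the angle is the same for the radii
    [expR s0] and [rho]. On the small circle it is close to 2 pi times the real part of [K 0], on
    the large one at most 2 pi [B] in modulus. *)
Lemma Re_mean_value_bound K r rho B :
  (forall w, 0 < rnorm w < r -> exists c : R[i], cderiv K w c) ->
  {for 0, continuous K} -> 0 < rho < r ->
  (forall w, rnorm w = rho -> rnorm (K w) <= B) -> `|complex.Re (K 0)| <= B.
Proof.
move=> Kd K0 /andP[rho0 rhor] KB; apply/ler_addgt0Pr => e e0.
have /nbhs_rnormP[x x0 Kx] : nbhs 0 [set w | rnorm (K 0 - K w) < e].
  by move/cvg_rnormP : K0; apply.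
(* Subtracting 1 from the minimum places the inner circle strictly inside both the outer circle and
   the disc where [K] is [e]-close to [K 0]. *)
pose s1 := ln rho; pose s0 := Num.min (ln rho) (ln x) - 1.
have s0x : expR s0 < x.
  by rewrite -[ltRHS]lnK ?posrE // ltr_expR /s0 ltrBlDr gt_min ltrDl ltr01 orbT.
have s01 : s0 < s1 by rewrite /s0 ltrBlDr gt_min ltrDl ltr01.
pose P s t := complex.Im (K (polar s t)).
pose Q s t := complex.Re (K (polar s t)).
have PQ s t : s <= s1 -> closed_at P Q s t.
  move=> ss1; have [|d dE] := Kd (polar s t); last exact: closed_at_polar dE.
  rewrite rnorm_polar expR_gt0 (le_lt_trans _ rhor) //.
  by rewrite -[leRHS]lnK ?posrE // ler_expR.
have pi0 : 0 < (pi : R) *+ 2 by rewrite mulrn_wgt0 // pi_gt0.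
have := @goursat R P Q s0 0 (s1 - s0) (pi *+ 2) _ pi0 _.
rewrite /circulation subr_gt0 (addrC s0) subrK s01 => /(_ isT) circ0.
have Pper : P^~ (0 + pi *+ 2) = P^~ 0.
  by apply/funext => s; rewrite /P polarDpi2.
have {circ0} Qeq : integ (Q s1) 0 (0 + pi *+ 2) = integ (Q s0) 0 (0 + pi *+ 2).
  have : integ (P^~ 0) s0 s1 + integ (Q s1) 0 (0 + pi *+ 2) -
    integ (P^~ (0 + pi *+ 2)) s0 s1 - integ (Q s0) 0 (0 + pi *+ 2) = 0.
    by apply: circ0 => u v /andP[_ us1] _; exact: PQ.
  by rewrite Pper; lra.
have Qc s : s <= s1 -> continuous_on (Q s) 0 (0 + pi *+ 2).
  by move=> ss1 t _; have [] := closed_continuous (PQ s t ss1).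
have pi20 : (0 : R) <= 0 + pi *+ 2 by rewrite add0r ltW.
have b0 : `|integ (Q s0) 0 (0 + pi *+ 2) - complex.Re (K 0) * (0 + pi *+ 2 - 0)|
    <= e * (0 + pi *+ 2 - 0).
  apply: integ_bound => //; first exact/Qc/ltW.
  move=> t _; rewrite /Q distrC -raddfB (le_trans (normr_Re_le _)) // ltW //.
  by apply: Kx; rewrite sub0r rnormN rnorm_polar.
have b1 : `|integ (Q s1) 0 (0 + pi *+ 2) - 0 * (0 + pi *+ 2 - 0)|
    <= B * (0 + pi *+ 2 - 0).
  apply: integ_bound => //; first exact/Qc.
  move=> t _; rewrite subr0 /Q (le_trans (normr_Re_le _)) // KB //.
  by rewrite rnorm_polar lnK.
rewrite -(ler_pM2r pi0); move: b0 b1; rewrite -Qeq mul0r !subr0 !add0r.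
move: (integ _ _ _) (complex.Re _) => I k.
rewrite -[X in _ -> _ -> `|_| * X <= _](gtr0_norm pi0) -normrM.
by rewrite !ler_norml; lra.
Qed.

(** Replacing the local factor by the difference quotient gives an equation valid for all [w], as
    [cderiv_quotient] requires. *)
Lemma cderiv_slope f (c : R[i]) : cderiv f 0 c -> exists phi,
  [/\ forall w, f w - f 0 = phi w * w, {for 0, continuous phi} & phi 0 = c].
Proof.
move=> [psi [psiE psic <-]].
exists (fun w => if w == 0 then psi 0 else (f w - f 0) / w); split; last by rewrite eqxx.
  by move=> w; case: eqVneq => [->|w0]; rewrite ?subrr ?mulr0 // mulfVK.
have N : \forall w \near 0, psi w = if w == 0 then psi 0 else (f w - f 0) / w.
  apply: filterS psiE => w; rewrite subr0 => ->.
  by case: eqVneq => [->//|w0]; rewrite mulfK.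
rewrite /prop_for /continuous_at eqxx.
exact: (cvg_trans (near_eq_cvg N) psic).
Qed.

(** The difference quotient [phi] is at most [2 * M / rho] on the circle. The mean value bound for
    [phi] and for [- 'i * phi] controls the real and imaginary parts of [phi 0], whence the factor
    4. *)
Lemma cauchy_estimate f d r rho M : 0 < rho < r ->
  (forall w, rnorm w < r -> cderiv f w (d w)) ->
  (forall w, rnorm w < r -> rnorm (f w) <= M) ->
  rnorm (d 0) <= 4 * M / rho.
Proof.
move=> rhor fd fM; have /andP[rho0 rhor'] := rhor.
have r0 : 0 < r by exact: lt_trans rhor'.
have r00 : rnorm (0 : R[i]) < r by rewrite rnorm0.
have [phi [phiE phic <-]] := cderiv_slope (fd 0 r00).
have phid w : 0 < rnorm w < r -> exists c : R[i], cderiv phi w c.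
  move=> /andP[w0 wr]; apply: cderiv_quotient phiE _ (fd w wr).
  by apply: contraTneq w0 => ->; rewrite rnorm0 ltxx.
have phiB w : rnorm w = rho -> rnorm (phi w) <= 2 * M / rho.
  move=> wrho; rewrite ler_pdivlMr // -{1}wrho -rnormM -phiE.
  have := fM w; have := fM 0 r00; rewrite wrho => h0 /(_ rhor') hw.
  by have := ler_rnormD (f w) (- f 0); rewrite rnormN; lra.
have re := Re_mean_value_bound phid phic rhor phiB.
have im : `|complex.Re (- 'i * phi 0)| <= 2 * M / rho.
  apply: (@Re_mean_value_bound (fun w => - 'i * phi w)  _ _ _ _ _ rhor).
  - by move=> w /phid[c cE]; exists (- 'i * c); exact: cderivZ.
  - apply: (ccvgM (F := nbhs 0)); [exact: (ccvg_cst (F := nbhs 0))|exact: phic].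
  - by move=> w /phiB; rewrite rnormM rnormN rnormi mul1r.
rewrite -Im_mulNi in im.
rewrite (le_trans (rnorm_le_ReIm _)) // (_ : 4 * M / rho = 2 * M / rho + 2 * M / rho).
  exact: lerD.
by rewrite -mulrDl; congr (_ / _); ring.
Qed.

(** The mean value theorem on the segment from [q] to [p]; it concerns real-valued functions, hence
    the real part. *)
Let real_lipschitz f p q L :
  (forall t : R, 0 <= t <= 1 -> exists2 c : R[i],
     cderiv f (q + t%:C * (p - q)) c & rnorm c <= L) ->
  `|complex.Re (f p - f q)| <= L * rnorm (p - q).
Proof.
move=> fL; pose g t := complex.Re (f (q + t%:C * (p - q))).
have gd (t : R) : exists c : R, 0 <= t <= 1 ->
    is_derive t 1 g c /\ `|c| <= L * rnorm (p - q).
  have [tI|] := boolP (0 <= t <= 1); last by exists 0.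
  have [c [phi [phiE phic phic0]] cL] := fL t tI.
  have lc : {for t, continuous (fun u : R => q + u%:C * (p - q))}.
    apply: ccvgD; first exact: ccvg_cst.
    apply: ccvgM; last exact: ccvg_cst.
    by apply: cvg_complex; [exact: cvg_id|exact: cvg_cst].
  pose psi (u : R) := complex.Re (phi (q + u%:C * (p - q)) * (p - q)).
  have psic : {for t, continuous psi}.
    apply: cvg_Re; apply: ccvgM; last exact: ccvg_cst.
    exact: (cvg_comp _ _ lc phic).
  have psiE : \forall u \near t, g u - g t = psi u * (u - t).
    apply: (@filterS _ (nbhs t) _ _ _ _ (lc _ phiE)) => u /= uE.
    rewrite /g -raddfB uE /psi.
    rewrite (_ : q + u%:C * (p - q) - (q + t%:C * (p - q)) = (u - t)%:C * (p - q)).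
      rewrite mulrCA mulrC; case: (phi _ * _) => x y /=; ring.
    rewrite rmorphB; ring.
  exists (psi t) => _; split; last first.
    by rewrite /psi phic0 (le_trans (normr_Re_le _)) // rnormM ler_wpM2r ?rnorm_ge0.
  apply/is_derive1_caratheodory.
  exists (fun u => if u == t then psi t else (g u - g t) / (u - t)); split.
  - by move=> u; case: eqVneq => [->|ut]; rewrite ?subrr ?mulr0 // mulfVK // subr_eq0.
  - have N : \forall u \near t, psi u = if u == t then psi t else (g u - g t) / (u - t).
      apply: filterS psiE => u uE; case: eqVneq => [->//|ut].
      by rewrite uE mulfK // subr_eq0.
    rewrite /prop_for /continuous_at eqxx.
    exact: (cvg_trans (near_eq_cvg N) psic).
  - by rewrite eqxx.
have [dg dgE] := choice gd.
have gdo (t : R) : t \in `]0, 1[ -> is_derive t 1 g (dg t).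
  by rewrite in_itv /= => /andP[t0 t1]; have [|//] := dgE t; rewrite !ltW.
have gc : {within `[0, 1], continuous g}.
  apply: derivable_within_continuous => t; rewrite in_itv /= => tI.
  by have [[]] := dgE t tI.
have [c cI] := MVT_segment ler01 gdo gc.
rewrite subr0 mulr1 /g rmorph1 rmorph0 mul1r mul0r addr0 [q + _]addrC subrK -raddfB => ->.
by move: cI; rewrite in_itv /= => /dgE[].
Qed.

(** Real and imaginary parts are estimated separately, which costs the factor 2. *)
Lemma cderiv_lipschitz f p q L :
  (forall t : R, 0 <= t <= 1 -> exists2 c : R[i],
     cderiv f (q + t%:C * (p - q)) c & rnorm c <= L) ->
  rnorm (f p - f q) <= 2 * L * rnorm (p - q).
Proof.
move=> fL; rewrite (le_trans (rnorm_le_ReIm _)) // -mulrA mulrDl mul1r.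
rewrite lerD ?real_lipschitz // Im_mulNi mulrBr.
apply: (@real_lipschitz (fun w => - 'i * f w)) => t /fL[c cE cL].
exists (- 'i * c); first exact: cderivZ.
by rewrite rnormM rnormN rnormi mul1r.
Qed.

(** The constants arise in turn: [16 * M] from Cauchy's estimate with radius 1/4, [32 * M] as
    Lipschitz constant of [f], [1024 * M] from Cauchy's estimate with radius 1/8 for
    [f (p + w) - f w], and [2048 * M] from the Lipschitz estimate for [f w - d 0 * w] between 0 and
    [z]. *)
Lemma cauchy_taylor f d M :
  (forall w, rnorm w < 1 -> cderiv f w (d w)) ->
  (forall w, rnorm w < 1 -> rnorm (f w) <= M) ->
  forall z, rnorm z <= 4^-1 -> rnorm (f z - f 0 - d 0 * z) <= 2048 * M * rnorm z ^+ 2.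
Proof.
move=> fd fM.
have M0 : 0 <= M by rewrite (le_trans _ (fM 0 _)) ?rnorm_ge0 // rnorm0.
have seg p q (t c : R) : 0 <= t <= 1 -> rnorm p <= c -> rnorm q <= c ->
    rnorm (q + t%:C * (p - q)) <= c.
  move=> /andP[t0 t1] pc qc.
  have -> : q + t%:C * (p - q) = (1 - t)%:C * q + t%:C * p by rewrite rmorphB; ring.
  rewrite (le_trans (ler_rnormD _ _)) // !rnormM !rnorm_real.
  rewrite (ger0_norm t0) (ger0_norm (_ : 0 <= 1 - t)) ?subr_ge0 //; nra.
have dB p : rnorm p <= 2^-1 -> rnorm (d p) <= 16 * M.
  (* The factor 1 gives the argument the shape [a + b * w] of [cderiv_affine]. *)
  move=> p2; have := @cauchy_estimate (fun w => f (p + 1 * w)) (fun w => 1 * d (p + 1 * w))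
    2^-1 4^-1 M.
  rewrite !mulr0 !mul1r addr0 (_ : 4 * M / 4^-1 = 16 * M); last by field.
  apply; first lra.
    move=> w w2; apply/cderiv_affine/fd; rewrite mul1r.
    by rewrite (le_lt_trans (ler_rnormD _ _)) //; lra.
  move=> w w2; apply: fM; rewrite mul1r.
  by rewrite (le_lt_trans (ler_rnormD _ _)) //; lra.
have fL p q : rnorm p <= 2^-1 -> rnorm q <= 2^-1 ->
    rnorm (f p - f q) <= 32 * M * rnorm (p - q).
  move=> p2 q2; rewrite (_ : 32 * M = 2 * (16 * M)); last by ring.
  apply: cderiv_lipschitz => t tI; have pq2 := seg p q t _ tI p2 q2.
  exists (d (q + t%:C * (p - q))); last exact: dB.
  by apply: fd; rewrite (le_lt_trans pq2) //; lra.
have dL p : rnorm p <= 4^-1 -> rnorm (d p - d 0) <= 1024 * M * rnorm p.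
  move=> p4.
  have := @cauchy_estimate (fun w => f (p + 1 * w) - f w) (fun w => 1 * d (p + 1 * w) - d w)
    4^-1 8^-1 (32 * M * rnorm p).
  rewrite !mulr0 !mul1r addr0 (_ : 4 * _ / 8^-1 = 1024 * M * rnorm p); last by field.
  have pw w : rnorm w < 4^-1 -> rnorm (p + 1 * w) <= 2^-1.
    by move=> w4; rewrite mul1r (le_trans (ler_rnormD _ _)) //; lra.
  apply; first lra.
    move=> w w4; apply: cderivB; last by apply: fd; lra.
    by apply/cderiv_affine/fd; have := pw w w4; lra.
  move=> w w4; rewrite -{2}(_ : p + 1 * w - w = p); last by ring.
  by apply: fL; [exact: pw|lra].
move=> z z4.
have := @cderiv_lipschitz (fun w => f w - d 0 * w) z 0 (1024 * M * rnorm z).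
rewrite subr0 mulr0 subr0 addrAC (_ : 2 * _ * _ = 2048 * M * rnorm z ^+ 2); last by ring.
apply=> t tI; rewrite add0r.
have tz : rnorm (t%:C * z) <= rnorm z.
  move: tI => /andP[t0 t1]; rewrite rnormM rnorm_real ger0_norm //.
  by rewrite ler_piMl ?rnorm_ge0.
exists (d (t%:C * z) - d 0).
  apply: cderivB; first by apply: fd; lra.
  by have := cderivZ (d 0) (cderiv_id (t%:C * z)); rewrite mulr1.
rewrite (le_trans (dL _ _)) //; first lra.
by apply: ler_wpM2l; [lra|exact: tz].
Qed.

End CauchyEstimate.

(** * The Hahn-Banach theorem for complex normed spaces *)

Section HahnBanach.
Context {R : realType} {V : normedModType R[i]}.
Implicit Types x y z : V.

Let rnormZr (a : R) x : rnorm (a%:C *: x) = `|a| * rnorm x.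
Proof. by rewrite rnormZ -rnorm_real. Qed.

(* Graphs of real-linear partial functions bounded above by the norm. *)
Let dominated (G : set (V * R)) :=
  (forall (a : R) p q, G p -> G q -> G (a%:C *: p.1 + q.1, a * p.2 + q.2)) /\
  (forall p, G p -> p.2 <= rnorm p.1).

Let ex_maximal x : exists G : set (V * R),
  [/\ dominated G, G (x, rnorm x) &
      forall H : set (V * R), dominated H -> G `<=` H -> H `<=` G].
Proof.
(* The condition on nonemptiness lets the union of the empty chain satisfy [P]; the line [L] through
   [x] then shows that the maximal [G] is not empty. *)
pose P (G : set (V * R)) := dominated G /\ (G !=set0 -> G (x, rnorm x)).
have [F FP totF|G [[Gd Gx] Gmax]] := @Zorn_bigcup _ P.
  split; last by move=> [p [X FX Xp]]; exists X => //; apply: (FP X FX).2; exists p.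
  split; last by move=> p [X FX Xp]; exact: (FP X FX).1.2.
  move=> a p q [X FX Xp] [Y FY Yq].
  have [XY|YX] := totF X Y FX FY.
    by exists Y => //; apply: (FP Y FY).1.1 => //; exact: XY.
  by exists X => //; apply: (FP X FX).1.1 => //; exact: YX.
pose L := [set p : V * R | exists a : R, p = (a%:C *: x, a * rnorm x)].
have PL : P L.
  split; last by move=> _; exists 1; rewrite scale1r mul1r.
  split=> [a _ _ [b ->] [c ->]|_ [a ->]] /=.
    by exists (a * b + c); rewrite rmorphD rmorphM scalerDl scalerA mulrDl mulrA.
  by rewrite rnormZr ler_wpM2r ?rnorm_ge0 // ler_norm.
have G0 : G !=set0.
  apply/set0P/eqP => G0; apply: (Gmax L) PL; rewrite G0; split=> // L0.
  by apply: (L0 (x, rnorm x)); exists 1; rewrite scale1r mul1r.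
exists G; split=> //; first exact: Gx.
move=> H Hd GH; apply: contrapT => nHG.
by apply: (Gmax H) => //; split=> // _; exact/GH/Gx.
Qed.

(** A maximal dominated graph is single-valued, since it contains [(0, r)] only for [r <= 0], and
    total, since otherwise it extends by one dimension. *)
Let real_hahn_banach x : exists u : V -> R,
  [/\ forall (a : R) y z, u (a%:C *: y + z) = a * u y + u z,
      forall y, u y <= rnorm y & u x = rnorm x].
Proof.
have [G [[Gl Gn] Gx Gmax]] := ex_maximal x.
have G0 : G (0, 0).
  by have := Gl (-1) _ _ Gx Gx; rewrite /= rmorphN rmorph1 scaleN1r mulN1r !addNr.
have Gz (r : R) : G (0, r) -> r <= 0 by move=> /Gn /=; rewrite rnorm0.
have Gfun y (r s : R) : G (y, r) -> G (y, s) -> r = s.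
  move=> yr ys; have le a b : G (y, a) -> G (y, b) -> a <= b.
    move=> ya yb; have := Gl (-1) _ _ yb ya.
    by rewrite /= rmorphN rmorph1 scaleN1r mulN1r addNr => /Gz; lra.
  by apply/eqP; rewrite eq_le !le.
have Gtot y : exists r, G (y, r).
  apply: contrapT => ny.
  pose S := [set p.2 - rnorm (p.1 - y) | p in G].
  have Sub p q : G p -> G q -> p.2 - rnorm (p.1 - y) <= rnorm (q.1 + y) - q.2.
    move=> Gp Gq; have := Gn _ (Gl 1 _ _ Gp Gq); rewrite /= rmorph1 scale1r mul1r.
    have -> : p.1 + q.1 = (p.1 - y) + (q.1 + y) by rewrite addrACA addNr addr0.
    by have := ler_rnormD (p.1 - y) (q.1 + y); lra.
  have S0 : S !=set0 by exists ((0 : R) - rnorm (0 - y)), (0, 0).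
  have Sb q : G q -> ubound S (rnorm (q.1 + y) - q.2).
    by move=> Gq _ [p Gp <-]; exact: Sub.
  (* The value of the extension at [y]: it separates the lower bounds forced at [p.1 - y] from the
     upper bounds forced at [q.1 + y]. *)
  pose c := sup S.
  have c1 p : G p -> p.2 - rnorm (p.1 - y) <= c.
    move=> Gp; apply: ub_le_sup; last by exists p.
    by exists (rnorm (0 + y) - 0); exact: (Sb (0, 0)).
  have c2 q : G q -> c <= rnorm (q.1 + y) - q.2.
    by move=> Gq; apply: ge_sup => //; exact: Sb.
  pose H := [set p : V * R | exists q (a : R), G q /\ p = (q.1 + a%:C *: y, q.2 + a * c)].
  have HG : H `<=` G.
    apply: Gmax; last by move=> p Gp; exists p, 0; rewrite scale0r mul0r !addr0; case: p Gp.
    split.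
      move=> a _ _ [p [b [Gp ->]]] [q [d [Gq ->]]] /=.
      exists (a%:C *: p.1 + q.1, a * p.2 + q.2), (a * b + d); split; first exact: Gl.
      congr (_, _); last by rewrite /=; ring.
      by rewrite /= rmorphD rmorphM scalerDl scalerDr scalerA addrACA.
    move=> _ [q [a [Gq ->]]] /=.
    have Ga b : G (b%:C *: q.1, b * q.2).
      by have := Gl b _ _ Gq G0; rewrite /= !addr0.
    (* Dividing by the modulus of [a] reduces domination to the coefficients -1 and 1, that is, to
       [c1] and [c2]. *)
    have [a0|a0|->] := ltgtP a 0; last by rewrite scale0r mul0r !addr0; exact: Gn.
      have na : 0 < - a by rewrite oppr_gt0.
      have := c1 _ (Ga (- a)^-1) => /=.
      have -> : ((- a)^-1)%:C *: q.1 - y = ((- a)^-1)%:C *: (q.1 + a%:C *: y).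
        rewrite scalerDr scalerA (_ : _ * _ = -1) ?scaleN1r //.
        by rewrite -rmorphM invrN mulNr mulVf ?lt_eqF // rmorphN1.
have ai : 0 <= (- a)^-1 by rewrite invr_ge0 ltW.
      rewrite rnormZr ger0_norm // -mulrBr ler_pdivrMl //.
      lra.
    have := c2 _ (Ga a^-1) => /=.
    have -> : (a^-1)%:C *: q.1 + y = (a^-1)%:C *: (q.1 + a%:C *: y).
      by rewrite scalerDr scalerA -rmorphM mulVf ?gt_eqF // rmorph1 scale1r.
    have ai : 0 <= a^-1 by rewrite invr_ge0 ltW.
    rewrite rnormZr ger0_norm // -mulrBr ler_pdivlMl //.
    lra.
  apply: ny; exists c; apply: HG; exists (0, 0), 1.
  by rewrite /= !add0r rmorph1 scale1r mul1r.
have [u uG] := choice Gtot.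
exists u; split.
- move=> a y z; apply: (Gfun (a%:C *: y + z)) => //.
  exact: (Gl a (y, u y) (z, u z)).
- by move=> y; exact: (Gn (y, u y)).
- exact: (Gfun x).
Qed.

(** The real functional [u] is the real part of the complex-linear functional sending y to u(y) - i
    u(iy). Rotating [y] bounds its norm by 1, and its real part at [x] is already [rnorm x]. *)
Theorem hahn_banach_norming x : exists2 phi : operator V R[i],
  opnorm phi <= 1 & rnorm x <= rnorm (phi x).
Proof.
have [u [ul un ux]] := real_hahn_banach x.
have u0 : u 0 = 0.
  by have := ul 1 0 0; rewrite scaler0 addr0 mul1r; lra.
have uD y z : u (y + z) = u y + u z.
  by have := ul 1 y z; rewrite rmorph1 scale1r mul1r.
have uZ (a : R) y : u (a%:C *: y) = a * u y.
  by have := ul a y 0; rewrite u0 !addr0.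
have uN y : u (- y) = - u y.
  by have := uZ (-1) y; rewrite rmorphN rmorph1 scaleN1r mulN1r.
pose phi y : R[i] := u y +i* - u ('i *: y).
have ii y : 'i *: ('i *: y) = - y.
  rewrite scalerA (_ : 'i * 'i = -1) ?scaleN1r //.
  by apply/eqP; rewrite eq_complex /=; apply/andP; split; apply/eqP; ring.
have phil : linear phi.
  move=> a y z; have aE : a = (complex.Re a)%:C + 'i * (complex.Im a)%:C.
    by case: a => a b; apply/eqP; rewrite eq_complex /=; apply/andP; split; apply/eqP; ring.
  rewrite {1}aE scalerDl mulrC -scalerA /phi.
  have -> : 'i *: ((complex.Re a)%:C *: y + (complex.Im a)%:C *: ('i *: y) + z)
     = (complex.Re a)%:C *: ('i *: y) - (complex.Im a)%:C *: y + 'i *: z.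
    rewrite !scalerDr ![_ *: (_%:C *: _)]scalerA ![_ * _%:C]mulrC -!scalerA ii.
    by rewrite scalerN.
  rewrite !uD !uN !uZ; case: (a) => b c /=.
  by apply/eqP; rewrite eq_complex /=; apply/andP; split; apply/eqP; ring.
have phin y : rnorm (phi y) <= 1 * rnorm y.
  rewrite mul1r.
  have [->|p0] := eqVneq (phi y) 0; first by rewrite rnorm0 rnorm_ge0.
  have np0 : 0 < rnorm (phi y) by exact: rnorm_gt0.
  (* rotate [y] so that [phi y] becomes the nonnegative real [rnorm (phi y)] *)
  pose c := (rnorm (phi y))%:C / phi y.
  have cE : c * phi y = (rnorm (phi y))%:C by rewrite /c mulfVK.
  have cn : rnorm c = 1.
    apply: (mulIf (lt0r_neq0 np0)); rewrite mul1r -rnormM cE rnorm_real.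
    by rewrite ger0_norm // rnorm_ge0.
  have phic : phi (c *: y) = c * phi y.
    have := phil c y 0; rewrite !addr0 => ->.
    have -> : phi 0 = 0 by rewrite /phi scaler0 u0 oppr0.
    by rewrite addr0.
  have : u (c *: y) = rnorm (phi y).
    by rewrite -[LHS]/(complex.Re (phi (c *: y))) phic cE.
  move=> <-; rewrite (le_trans (un _)) // rnormZ -[X in X * _]/(rnorm c).
  by rewrite cn mul1r.
have phio := bounded_is_operator phil phin.
exists (Operator phio); first by apply: opnorm_le => //; exact: phin.
by rewrite -ux -[u x]/(complex.Re (phi x)) (le_trans (ler_norm _)) // normr_Re_le.
Qed.

Lemma rnorm_le_dual x (M : R) :
  (forall phi : operator V R[i], opnorm phi <= 1 -> rnorm (phi x) <= M) -> rnorm x <= M.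
Proof.
by move=> h; have [phi p1 px] := hahn_banach_norming x; rewrite (le_trans px) // h.
Qed.

End HahnBanach.

(** * Linearization *)

Section Frechet.
Context {R : realType} {V W : normedModType R[i]}.
Implicit Types (f : V -> W) (x h : V).

Lemma differentiable_rnorm f x : differentiable f x ->
  forall e : R, 0 < e -> exists2 d : R, 0 < d &
    forall h, rnorm h < d -> rnorm (f (x + h) - f x - 'd f x h) <= e * rnorm h.
Proof.
move=> /diff_locally/eqaddoP fx e e0.
have := fx e%:C; rewrite ltcR => /(_ e0)/nbhs_rnormP[d d0 dP].
exists d => // h hd; have := dP h; rewrite sub0r rnormN => /(_ hd).
rewrite /= !rnormE -rmorphM lecR opprD addrA (addrC x).
exact.
Qed.

Lemma rnorm_differentiable f x (L : operator V W) :
  (forall e : R, 0 < e -> exists2 d : R, 0 < d &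
    forall h, rnorm h < d -> rnorm (f (x + h) - f x - L h) <= e * rnorm h) ->
  differentiable f x.
Proof.
move=> fL; have H : f \o shift x = cst (f x) + (L : V -> W) +o_ 0 id.
  apply/eqaddoP => e e0.
  have eE : e = (complex.Re e)%:C.
    by move: e0; rewrite ltcE; case: (e) => a b /= /andP[/eqP->].
  have [|d d0 dP] := fL (complex.Re e); first by rewrite -ltcR -eE.
  apply/nbhs_rnormP; exists d => // h; rewrite sub0r rnormN => /dP.
  by rewrite eE !rnormE -rmorphM lecR /= opprD addrA (addrC x).
have Lc : continuous (L : V -> W) := @operator_continuous _ _ _ L.
apply/diff_locallyP; rewrite (diff_unique Lc H).
by split.
Qed.

End Frechet.

(** * Restriction to complex lines *)

Section Slices.
Context {R : realType} {V : normedModType R[i]}.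

Lemma cderiv_slice (f : V -> R[i]) (x v : V) (z : R[i]) :
  differentiable f (x + z *: v) ->
  cderiv (fun t => f (x + t *: v)) z ('d f (x + z *: v) v).
Proof.
move=> fd; set D := 'd f _ v.
exists (fun t => if t == z then D else (f (x + t *: v) - f (x + z *: v)) / (t - z)).
split; last by rewrite eqxx.
  apply: filterE => t; case: eqVneq => [->|tz]; first by rewrite !subrr mulr0.
  by rewrite mulfVK // subr_eq0.
rewrite /prop_for /continuous_at eqxx.
apply/(@cvg_rnormP _ _ _ (nbhs z)) => e e0.
have v1 : 0 < rnorm v + 1 by rewrite ltr_wpDl // rnorm_ge0.
(* What is needed is [k * rnorm v < e]; adding 1 to [rnorm v] covers [v = 0]. *)
have [k k0 kE] : exists2 k, 0 < k & k * (rnorm v + 1) = e / 2.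
  by exists (e / 2 / (rnorm v + 1)); rewrite ?mulfVK ?gt_eqF // !divr_gt0.
have [d d0 dP] := differentiable_rnorm fd k0.
apply/nbhs_rnormP; exists (d / (rnorm v + 1)); first by rewrite divr_gt0.
move=> t zt; rewrite /mkset; have [tz|tz] := ifPn; first by rewrite subrr rnorm0.
have tz0 : t - z != 0 by rewrite subr_eq0.
have ntz : 0 < rnorm (t - z) by exact: rnorm_gt0.
have tv : rnorm ((t - z) *: v) < d.
  rewrite rnormZ -[X in X * _]/(rnorm (t - z)) -rnormN opprB.
  rewrite ltr_pdivlMr // in zt; apply: le_lt_trans zt.
  by rewrite ler_wpM2l ?rnorm_ge0 // lerDl.
have := dP _ tv; rewrite (_ : _ + (t - z) *: v = x + t *: v); last first.
  by rewrite -addrA -scalerDl (addrC z) subrK.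
rewrite linearZ /= -/D => h.
rewrite -rnormN opprB -(ltr_pM2r ntz) -rnormM mulrBl mulfVK //.
rewrite [D * _]mulrC (le_lt_trans h) // rnormZ -[X in _ * (X * _)]/(rnorm (t - z)).
by rewrite mulrCA [ltRHS]mulrC ltr_pM2l //; lra.
Qed.

End Slices.

Section ValL.
Context {R : realType} {E F : completeNormedModType R[i]}.
Implicit Types U : set E.

Lemma valL0E U (f : U -> F) (y : U) : 'valL_0 f (\val y) = f y.
Proof. exact: (congr1 (@^~ y) (valLK 0 f)). Qed.

Lemma valL0_comp (G : completeNormedModType R[i]) U (f : U -> F) (T : operator F G) :
  'valL_0 (T \o f) = T \o 'valL_0 f :> (E -> G).
Proof. by apply/funext => x /=; case: ('oinv_set_val x) => //=; rewrite linear0. Qed.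

Lemma holomorphic_comp (G : completeNormedModType R[i]) U (f : U -> F) (T : operator F G) :
  holomorphic f -> holomorphic (T \o f).
Proof.
move=> fh x; rewrite valL0_comp; apply: differentiable_comp; first exact: fh.
apply: linear_differentiable; exact: operator_continuous.
Qed.

End ValL.

Section Linearization.
Context {R : realType} {E : completeNormedModType R[i]} (U : weighted_open E).
Implicit Types F G : completeNormedModType R[i].

Lemma Hv_comp F G (f : U -> F) (T : operator F G) : Hv f ->
  Hv (T \o f) /\ wnorm (T \o f) <= opnorm T * wnorm f.
Proof.
move=> Hf.
have b x : weight x * rnorm ((T \o f) x) <= opnorm T * wnorm f.
  rewrite (@le_trans _ _ (weight x * (opnorm T * rnorm (f x)))) //.
    by rewrite ler_wpM2l ?le_opnorm // ltW // weight_gt0.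
  by rewrite mulrCA ler_wpM2l ?opnorm_ge0 ?le_wnorm.
split; last by apply: wnorm_le => //; rewrite mulr_ge0 ?opnorm_ge0 ?wnorm_ge0.
split; first by apply: holomorphic_comp; case: Hf.
by exists (opnorm T * wnorm f) => _ [x _ <-].
Qed.

Lemma rnorm_evaluation (x : U) : rnorm (evaluation x) <= (weight x)^-1.
Proof.
rewrite rnorm_operator; apply: opnorm_le => [|f].
  by rewrite invr_ge0 ltW // weight_gt0.
by rewrite ler_pdivlMl ?weight_gt0 // rnorm_Hv le_wnorm //; exact: Hv_typeP.
Qed.

Lemma operator_sumE (V W : normedModType R[i]) n (T : 'I_n -> operator V W) v :
  (\sum_(i < n) T i) v = \sum_(i < n) T i v.
Proof. by elim/big_rec2: _ => // i y S _ <-. Qed.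

Lemma span_evaluation_sum (g : operator (Hv_type U R[i]) R[i]) :
  span (range (@evaluation R E U)) g -> exists n (a : 'I_n -> R[i]) (s : 'I_n -> U),
    g = \sum_(i < n) a i *: evaluation (s i).
Proof.
move=> [n [a [s [Ss ->]]]].
have ex i : exists x, evaluation x = s i by have [x _ <-] := Ss i; exists x.
have [t tE] := choice ex.
by exists n, a, t; apply: eq_bigr => i _; rewrite tE.
Qed.

Lemma Gv_dense (g : Gv U) (e : R) : 0 < e ->
  exists2 s : Gv U, span (range (@evaluation R E U)) (closed_span_val s) & rnorm (g - s) < e.
Proof.
move=> e0; have /asboolP/closure_rnormP/(_ e e0)[s Ss gs] := valP g.
have sP : s \in in_closed_span (range (@evaluation R E U)).
  by apply/asboolP/subset_closure.
by exists (ClosedSpan sP).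
Qed.

(** The difference [D] vanishes at every [Delta x], hence on their span, and by density and
    boundedness everywhere. *)
Lemma Gv_ext F (S T : operator (Gv U) F) : S \o @Delta R E U = T \o @Delta R E U -> S = T.
Proof.
move=> ST; apply/eqP; rewrite -subr_eq0; apply/eqP.
set D := S - T; apply/val_inj/funext => g; change (D g = 0).
apply/rnorm0_eq0/eqP; rewrite eq_le rnorm_ge0 andbT.
apply/ler_addgt0Pr => e e0; rewrite add0r.
have D1 : 0 < opnorm D + 1 by rewrite ltr_wpDl // opnorm_ge0.
have [s Ss gs] := Gv_dense g (divr_gt0 e0 D1).
have Ds : D s = 0.
  have [n [a [t sE]]] := span_evaluation_sum Ss.
  have -> : s = \sum_(i < n) a i *: Delta (t i).
    apply: val_inj; rewrite raddf_sum [LHS]sE; exact: eq_bigr.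
  rewrite linear_sum big1 // => i _.
  have := congr1 (@^~ (t i)) ST => /= STi.
  transitivity (a i *: (S (Delta (t i)) - T (Delta (t i)))); last first.
    by rewrite STi subrr scaler0.
  exact: (@linearZ_LR _ _ _ _ D (a i) (Delta (t i))).
rewrite -[D g]subr0 -Ds -linearB (le_trans (le_opnorm _ _)) //.
rewrite ltr_pdivlMr // in gs; apply: le_trans (ltW gs).
by rewrite mulrC ler_wpM2l ?rnorm_ge0 // lerDl.
Qed.

Lemma linearization_unique F (T : operator (Gv U) F) :
  linearization (T \o @Delta R E U) = T.
Proof.
apply: Gv_ext; apply: (@getPex _ [set S : operator (Gv U) F |
  S \o @Delta R E U = T \o @Delta R E U]).
by exists T.
Qed.

(** * Existence of the linearization *)

Section existence.
Variables (F : completeNormedModType R[i]) (f : U -> F).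
Hypothesis Hf : Hv f.

Let pullback (phi : operator F R[i]) : Hv_type U R[i] :=
  HvType (asboolT (Hv_comp phi Hf).1 : phi \o f \in @in_Hv R E U R[i]).

Let represents (g : Gv U) (y : F) :=
  forall phi : operator F R[i], phi y = closed_span_val g (pullback phi).

(** By Hahn-Banach it suffices to test with functionals of norm at most 1, whose pullbacks have norm
    at most [wnorm f]. This inequality yields uniqueness of [y], boundedness of the operator and the
    Cauchy property of approximations. *)
Let represents_le g1 g2 y1 y2 : represents g1 y1 -> represents g2 y2 ->
  rnorm (y1 - y2) <= wnorm f * rnorm (g1 - g2).
Proof.
move=> r1 r2; apply: rnorm_le_dual => phi phi1.
rewrite linearB /= r1 r2.
rewrite [X in rnorm X](_ : _ = closed_span_val (g1 - g2) (pullback phi)) //.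
rewrite (le_trans (le_opnorm _ _)) // mulrC.
rewrite [leRHS](_ : _ = wnorm f * opnorm (closed_span_val (g1 - g2))) //.
rewrite ler_wpM2r ?opnorm_ge0 // rnorm_Hv (le_trans (Hv_comp phi Hf).2) //.
by rewrite ler_piMl // wnorm_ge0.
Qed.

Let represents_lin a g1 g2 y1 y2 : represents g1 y1 -> represents g2 y2 ->
  represents (a *: g1 + g2) (a *: y1 + y2).
Proof. by move=> r1 r2 phi; rewrite linearP /= r1 r2. Qed.

Let represents_span (g : Gv U) :
  span (range (@evaluation R E U)) (closed_span_val g) -> exists y, represents g y.
Proof.
move=> /span_evaluation_sum[n [a [s gE]]]; exists (\sum_(i < n) a i *: f (s i)) => phi.
rewrite gE operator_sumE linear_sum; apply: eq_bigr => i _.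
by rewrite linearZ.
Qed.

(** Elements of the span close to [g] are represented by finite sums. By [represents_le] the
    representing vectors form a Cauchy sequence, and its limit in [F] represents [g]. *)
Let ex_represents (g : Gv U) : exists y, represents g y.
Proof.
have app n : exists sy : Gv U * F, represents sy.1 sy.2 /\ rnorm (g - sy.1) < n.+1%:R^-1.
  have [|s /represents_span[y sy] gs] := Gv_dense g (_ : 0 < n.+1%:R^-1).
    by rewrite invr_gt0 ltr0Sn.
  by exists (s, y).
have [sy syP] := choice app.
have wf : 0 < wnorm f + 1 by rewrite ltr_wpDl // wnorm_ge0.
have lim0 (e : R) : 0 < e -> \forall n \near \oo, n.+1%:R^-1 < e.
  by move=> e0; exact: (near_infty_natSinv_lt (PosNum e0)).
have dist y h n : represents h y ->
    rnorm (y - (sy n).2) <= (wnorm f + 1) * rnorm (h - (sy n).1).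
  move=> hy; rewrite (le_trans (represents_le hy (syP n).1)) // ler_wpM2r ?rnorm_ge0 //.
  by rewrite lerDl.
have : cvg ((fun n => (sy n).2) @ \oo).
  apply/cauchy_cvgP/cauchy_rnormP => e e0.
  have e2 : 0 < e / (wnorm f + 1) / 2 by rewrite !divr_gt0.
  have [N _ NP] := lim0 _ e2.
  exists (sy N).2; exists N => // n Nn /=.
  rewrite (le_lt_trans (dist _ _ _ (syP N).1)) // mulrC -ltr_pdivlMr //.
  rewrite -(subrKA g) (le_lt_trans (ler_rnormD _ _)) // [ltRHS]splitr.
  rewrite ltrD //; last exact: lt_trans (syP n).2 (NP n Nn).
  by rewrite -rnormN opprB; exact: lt_trans (syP N).2 (NP N (leqnn N)).
move=> /cvg_ex[y /cvg_rnormP yP]; exists y => phi.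
apply/eqP; rewrite -subr_eq0; apply/eqP/rnorm0_eq0/eqP.
rewrite eq_le rnorm_ge0 andbT; apply/ler_addgt0Pr => e e0; rewrite add0r.
(* The two approximation errors are weighted by the norms of [phi] and [pullback phi]; the 1 keeps
   [c] positive. *)
pose c := opnorm phi + rnorm (pullback phi) + 1.
have c0 : 0 < c by rewrite /c ltr_wpDl // addr_ge0 ?opnorm_ge0 ?rnorm_ge0.
have ec : 0 < e / c by rewrite divr_gt0.
have [n [/= n1 n2]] := filter_ex (filterI (yP _ ec) (lim0 _ ec)).
have gn : rnorm (g - (sy n).1) < e / c by apply: lt_trans n2; exact: (syP n).2.
have -> : phi y - closed_span_val g (pullback phi) = phi (y - (sy n).2) -
    closed_span_val (g - (sy n).1) (pullback phi).
  rewrite linearB /= (syP n).1.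
  rewrite -[RHS]/(phi y - closed_span_val (sy n).1 (pullback phi) -
    (closed_span_val g (pullback phi) - closed_span_val (sy n).1 (pullback phi))).
  by rewrite opprB addrA addrNK.
rewrite (le_trans (ler_rnormD _ _)) // rnormN.
have h1 := le_opnorm phi (y - (sy n).2).
have h2 : rnorm (closed_span_val (g - (sy n).1) (pullback phi)) <=
    rnorm (g - (sy n).1) * rnorm (pullback phi) := le_opnorm _ _.
rewrite (le_trans (lerD h1 h2)) //.
rewrite ltr_pdivlMr // in n1; rewrite ltr_pdivlMr // in gn.
have p1 : opnorm phi * rnorm (y - (sy n).2) <= opnorm phi * (e / c).
  by rewrite ler_wpM2l ?opnorm_ge0 // ler_pdivlMr // ltW.
have p2 : rnorm (g - (sy n).1) * rnorm (pullback phi) <= e / c * rnorm (pullback phi).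
  by rewrite ler_wpM2r ?rnorm_ge0 // ler_pdivlMr // ltW.
have -> : e = e / c * c by rewrite mulfVK // gt_eqF.
rewrite (le_trans (lerD p1 p2)) // [X in X + _]mulrC -mulrDr.
by apply: (ler_wpM2l (ltW ec)); rewrite /c lerDl.
Qed.

Lemma linearizationE : linearization f \o @Delta R E U = f.
Proof.
apply: (@getPex _ [set T : operator (Gv U) F | T \o @Delta R E U = f]).
have [T TP] := choice ex_represents.
have uniq g y1 y2 : represents g y1 -> represents g y2 -> y1 = y2.
  move=> r1 r2; apply/eqP; rewrite -subr_eq0; apply/eqP/rnorm0_eq0/eqP.
  rewrite eq_le rnorm_ge0 andbT (le_trans (represents_le r1 r2)) //.
  by rewrite subrr rnorm0 mulr0.
have Tl : linear T.
  by move=> a g h; apply: uniq (TP _) _; exact: represents_lin.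
have Tn g : rnorm (T g) <= wnorm f * rnorm g.
  (* Comparison with the pair of zeros turns the Lipschitz bound into a norm bound. *)
  have r0 : represents 0 0 by move=> phi; rewrite linear0.
  by have := represents_le (TP g) r0; rewrite !subr0.
exists (Operator (bounded_is_operator Tl Tn)).
by apply/funext => x /=; apply: uniq (TP _) _ => phi.
Qed.

End existence.

End Linearization.

(** * Holomorphy of the evaluation map *)

Lemma diff_linear_combination {K : numFieldType} {V W : normedModType K} (f g : V -> W) a x h :
  differentiable f x -> differentiable g x ->
  'd (a *: f + g) x h = a *: 'd f x h + 'd g x h.
Proof. by move=> df dg; rewrite diffD ?diffZ //; exact: differentiableZ. Qed.

Section DeltaHolomorphic.
Context {R : realType} {E : completeNormedModType R[i]} (U : weighted_open E).

(** Since an evaluation has norm at most the inverse weight, this bounds the unit ball of [Hv_type U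
    R[i]] uniformly near [x]. By continuity the weight stays above [weight x / 2] there. *)
Lemma weight_locally_bounded (x : U) : exists2 r : R, 0 < r & forall h : E,
  rnorm h < r -> exists2 y : U, \val y = \val x + h & (weight y)^-1 <= 2 / weight x.
Proof.
have wx := weight_gt0 x.
have w2 : 0 < weight x / 2 by rewrite divr_gt0.
have /cvgrPdist_lt/(_ _ w2)[_ [[W oW <-] /= Wx sW]] := @weight_continuous _ _ U x.
have : nbhs (\val x) (W `&` U).
  apply: filterI; apply: open_nbhs_nbhs; split=> //; first exact: carrier_open.
  exact/set_mem/valP.
move=> /nbhs_rnormP[r r0 rP]; exists r => // h hr.
have [|Wy Uy] := rP (\val x + h); first by rewrite opprD addNKr rnormN.
pose y : U := SigSub (mem_set Uy); exists y => //.
have /= := sW y Wy; set w := weight y => ww.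
have w0 : weight x / 2 < w by move: ww; rewrite ltr_norml; lra.
rewrite -[leRHS]invrK lef_pV2 ?posrE ?invr_gt0 ?divr_gt0 //; last exact: lt_trans w0.
by rewrite invfM invrK mulrC ltW.
Qed.

(** [cauchy_taylor] is applied along the direction of [h], rescaled to a vector [v] of norm [r], at
    the point [rnorm h / r]; its bound 1/4 on the argument explains the radius [r / 4]. The
    constants are uniform in [f]. *)
Lemma Hv_taylor (x : U) : exists r C : R, [/\ 0 < r, 0 < C & forall h : E,
  rnorm h <= r -> exists y : U, [/\ \val y = \val x + h, opnorm (evaluation y) <= C &
    forall f : Hv_type U R[i],
      rnorm (f y - f x - 'd ('valL_0 f : E -> R[i]) (\val x) h) <= C * rnorm f * rnorm h ^+ 2]].
Proof.
have [r r0 rP] := weight_locally_bounded x.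
have wx := weight_gt0 x; pose M := 2 / weight x.
have M0 : 0 < M by rewrite divr_gt0.
(* The first entry bounds the evaluations, the second is the Taylor constant rescaled from radius 1
   to [r]. *)
pose C := Num.max M (2048 * M / r ^+ 2).
exists (r / 4), C; split; first by rewrite divr_gt0.
  by rewrite lt_max M0.
move=> h hr; have [|y yE yw] := rP h; first by lra.
exists y; split=> //.
  by rewrite -rnorm_operator (le_trans (rnorm_evaluation y)) // le_max yw.
move=> f; have [h0|h0] := eqVneq h 0.
  have -> : y = x by apply: val_inj; rewrite yE h0 addr0.
  by rewrite h0 linear0 !subrr !rnorm0 expr0n mulr0.
have nh : 0 < rnorm h by exact: rnorm_gt0.
pose v := (r / rnorm h)%:C *: h.
have nv : rnorm v = r.
  rewrite rnormZ -[X in X * _]/(rnorm (_%:C)) rnorm_real ger0_norm.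
    by rewrite mulfVK // gt_eqF.
  by rewrite divr_ge0 // ltW.
have small (w : R[i]) : rnorm w < 1 -> rnorm (w *: v) < r.
  by move=> w1; rewrite rnormZ -[X in X * _]/(rnorm w) nv gtr_pMl.
pose F : E -> R[i] := 'valL_0 f.
have Fh (z : U) : differentiable F (\val z) by case: (Hv_typeP f) => + _; apply.
have FE (z : U) : F (\val z) = f z by exact: valL0E.
pose t := rnorm h / r.
have tv : t%:C *: v = h.
  rewrite scalerA -rmorphM /t (_ : _ * _ = 1) ?rmorph1 ?scale1r //.
  by field; rewrite !gt_eqF.
have := @cauchy_taylor R (fun w => F (\val x + w *: v)) (fun w => 'd F (\val x + w *: v) v)
  (M * rnorm f) _ _ t%:C _.
rewrite tv scale0r addr0 -yE !FE.
rewrite (_ : _ * t%:C = 'd F (\val x) h); last first.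
  by rewrite -[in RHS]tv [RHS]linearZ [LHS]mulrC.
rewrite rnorm_real ger0_norm ?divr_ge0 ?rnorm_ge0 ?(ltW r0) // => tay.
apply: (@le_trans _ _ (2048 * (M * rnorm f) * t ^+ 2)).
  apply: tay.
  - by move=> w /small/rP[z zE _]; apply: cderiv_slice; rewrite -zE.
  - move=> w /small/rP[z zE zw]; rewrite -zE FE.
    have ez : rnorm (f z) <= opnorm (evaluation z) * rnorm f := le_opnorm (evaluation z) f.
    apply: le_trans ez _; apply: ler_wpM2r; first exact: rnorm_ge0.
    exact: le_trans (rnorm_evaluation z) zw.
  - by rewrite ler_pdivrMr // mulrC.
rewrite (_ : 2048 * _ * _ = 2048 * M / r ^+ 2 * rnorm f * rnorm h ^+ 2); last first.
  by rewrite /t; field; rewrite gt_eqF.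
rewrite ler_wpM2r ?exprn_ge0 ?rnorm_ge0 // ler_wpM2r ?rnorm_ge0 //.
by rewrite /C le_max lexx orbT.
Qed.

(** * The derivative of [Delta] at a point *)

Section derivative.
Variables (x : U) (r C : R).
Hypotheses (r0 : 0 < r) (C0 : 0 < C).
Hypothesis taylor : forall h : E,
  rnorm h <= r -> exists y : U, [/\ \val y = \val x + h, opnorm (evaluation y) <= C &
    forall f : Hv_type U R[i],
      rnorm (f y - f x - 'd ('valL_0 f : E -> R[i]) (\val x) h) <= C * rnorm f * rnorm h ^+ 2].

(** The candidate for the derivative of [Delta] in the direction [h], as a functional of [f]. *)
Let dval (h : E) (f : Hv_type U R[i]) : R[i] := 'd ('valL_0 f : E -> R[i]) (\val x) h.

Let dval_linear h : linear (dval h).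
Proof.
move=> a f g; rewrite /dval.
have df (k : Hv_type U R[i]) : differentiable ('valL_0 k : E -> R[i]) (\val x).
  by case: (Hv_typeP k) => + _; apply.
have -> : 'valL_0 (a *: f + g) = a *: ('valL_0 f : E -> R[i]) + ('valL_0 g : E -> R[i])
    :> (E -> R[i]).
  apply/funext => y; rewrite [RHS]/(a *: 'valL_0 f y + 'valL_0 g y) /=.
  case: ('oinv_set_val y) => [z|]; first by [].
  exact: (esym (etrans (addr0 _) (scaler0 _ _))).
exact: (@diff_linear_combination R[i] E R[i] ('valL_0 f) ('valL_0 g)).
Qed.

Let small_multiple (h : E) (e : R) : 0 < e -> exists2 t : R, 0 < t & t * rnorm h <= e.
Proof.
move=> e0; have h1 : 0 < rnorm h + 1 by rewrite ltr_wpDl // rnorm_ge0.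
exists (e / (rnorm h + 1)); first by rewrite divr_gt0.
by rewrite mulrAC ler_pdivrMr // ler_pM2l // lerDl.
Qed.

Let rnormZ_pos (V : normedModType R[i]) (t : R) (v : V) :
  0 < t -> rnorm (t%:C *: v) = t * rnorm v.
Proof. by move=> t0; rewrite rnormZ -[X in X * _]/(rnorm (t%:C)) rnorm_real gtr0_norm. Qed.

(** The Taylor bound at [t%:C *: h] divided by [t]: difference quotients of evaluations approach
    [dval h] uniformly on the unit ball. *)
Let dval_approx h (t : R) : 0 < t -> t * rnorm h <= r -> exists y : U,
  \val y = \val x + t%:C *: h /\ forall f,
  rnorm (dval h f - (t^-1)%:C * (f y - f x)) <= C * (t * rnorm h ^+ 2) * rnorm f.
Proof.
move=> t0 th; have [|y [yE _ yP]] := taylor (h := t%:C *: h); first by rewrite rnormZ_pos.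
exists y; split=> // f; have := yP f; rewrite linearZ /= -/(dval h f) rnormZ_pos // => le1.
have scaled : t%:C *: (dval h f - (t^-1)%:C * (f y - f x)) =
    - (f y - f x - t%:C *: dval h f).
  rewrite scalerBr opprB; congr (_ - _).
  by rewrite -[LHS]/(t%:C * (_ * _)) mulrA -rmorphM mulfV ?gt_eqF // rmorph1 mul1r.
rewrite -(ler_pM2l t0) -[leLHS](rnormZ_pos _ t0) scaled rnormN.
by apply: le_trans le1 _; rewrite le_eqVlt; apply/orP; left; apply/eqP; ring.
Qed.

Let dval_operator h : dval h \in @is_operator R (Hv_type U R[i]) R[i].
Proof.
have [t t0 th] := small_multiple h r0.
have [y [_ yP]] := dval_approx t0 th.
apply: (bounded_is_operator (M := C * (t * rnorm h ^+ 2) +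
  opnorm ((t^-1)%:C *: (evaluation y - evaluation x)))); first exact: dval_linear.
move=> f; rewrite -(subrK ((t^-1)%:C * (f y - f x)) (dval h f)).
rewrite (le_trans (ler_rnormD _ _)) // mulrDl lerD //.
exact: (le_opnorm ((t^-1)%:C *: (evaluation y - evaluation x))).
Qed.

(** Difference quotients of evaluations lie in the span and converge to [dval h] in operator
    norm. *)
Let dval_Gv h : Operator (dval_operator h) \in in_closed_span (range (@evaluation R E U)).
Proof.
apply/asboolP/closure_rnormP => e e0.
have [t1 t10 th1] := small_multiple h r0.
have k0 : 0 < C * (rnorm h ^+ 2 + 1).
  by rewrite mulr_gt0 // ltr_wpDl // exprn_ge0 // rnorm_ge0.
(* The first entry keeps the displacement within radius [r], the second makes the error at most
   [e / 2]. *)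
pose t := Num.min t1 (e / 2 / (C * (rnorm h ^+ 2 + 1))).
have t0 : 0 < t by rewrite lt_min t10 !divr_gt0.
have th : t * rnorm h <= r.
  by rewrite (le_trans _ th1) // ler_wpM2r ?rnorm_ge0 // ge_min lexx.
have [y [_ yP]] := dval_approx t0 th.
exists ((t^-1)%:C *: (evaluation y - evaluation x)).
  have [S0 SD] := span_submod (range (@evaluation R E U)).
  have Se z : span (range (@evaluation R E U)) (evaluation z).
    exists 1%N, (fun=> 1), (fun=> evaluation z).
    by split=> [_|]; [exists z|rewrite big_ord1 scale1r].
  rewrite -[_ *: _]addr0; apply: (SD) => //.
  by rewrite -scaleN1r addrC; exact: SD.
rewrite rnorm_operator; apply: (@le_lt_trans _ _ (e / 2)); last by lra.
apply: opnorm_le => [|f]; first by lra.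
apply: le_trans (yP f) _; rewrite ler_wpM2r ?rnorm_ge0 //.
have : t * (C * (rnorm h ^+ 2 + 1)) <= e / 2.
  by rewrite -ler_pdivlMr // ge_min lexx orbT.
apply: le_trans; rewrite mulrCA ler_wpM2l ?(ltW t0) // ler_wpM2l ?(ltW C0) //.
by rewrite lerDl.
Qed.

Let dDelta (h : E) : Gv U := ClosedSpan (dval_Gv h).

Let dDelta_linear : linear dDelta.
Proof.
move=> a h k; apply/val_inj/val_inj/funext => f.
exact: (linearP ('d ('valL_0 f : E -> R[i]) (\val x)) a h k).
Qed.

Let dDelta0 : dDelta 0 = 0.
Proof. by have := dDelta_linear (-1) 0 0; rewrite scaler0 addr0 scaleN1r addNr. Qed.

Let dDelta_approx (y : U) h : \val y = \val x + h -> rnorm h <= r ->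
  rnorm (Delta y - Delta x - dDelta h) <= C * rnorm h ^+ 2.
Proof.
move=> yE hr; have [z [zE _ zP]] := taylor hr.
have -> : y = z by apply: val_inj; rewrite yE zE.
rewrite [leLHS](_ : _ = opnorm (evaluation z - evaluation x - Operator (dval_operator h))) //.
apply: opnorm_le => [|f]; first by rewrite mulr_ge0 ?exprn_ge0 ?rnorm_ge0 // ltW.
by rewrite mulrAC; exact: zP.
Qed.

(** On the sphere of radius [r], [dDelta k] is [Delta y - Delta x] up to the Taylor remainder, hence
    at most [2 * C + C * r ^+ 2]; homogeneity gives the rest. *)
Let dDelta_bound h : rnorm (dDelta h) <= (2 * C + C * r ^+ 2) / r * rnorm h.
Proof.
have [->|h0] := eqVneq h 0.
  by rewrite dDelta0 !rnorm0 mulr0.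
have nh : 0 < rnorm h by exact: rnorm_gt0.
pose k := (r / rnorm h)%:C *: h.
have nk : rnorm k = r by rewrite rnormZ_pos ?divr_gt0 // mulfVK // gt_eqF.
have dk : rnorm (dDelta k) = r / rnorm h * rnorm (dDelta h).
  rewrite -rnormZ_pos ?divr_gt0 //; congr rnorm.
  have := dDelta_linear (r / rnorm h)%:C h 0; rewrite !addr0 => ->.
  by rewrite dDelta0 addr0.
have [|y [yE yC _]] := taylor (h := k); first by rewrite nk.
(* The displacement 0 gives the bound on the evaluation at [x] itself. *)
have [|x' [x'E xC _]] := taylor (h := 0); first by rewrite rnorm0 ltW.
have {x'E} xx : x' = x by apply: val_inj; rewrite x'E addr0.
rewrite xx in xC.
have : rnorm (dDelta k) <= 2 * C + C * r ^+ 2.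
  rewrite -(subKr (Delta y - Delta x) (dDelta k)) (le_trans (ler_rnormD _ _)) //.
  rewrite rnormN lerD //; last first.
    by have := dDelta_approx yE; rewrite nk => ->.
  rewrite (le_trans (ler_rnormD _ _)) // rnormN mulrDl mul1r lerD //.
rewrite dk => le1; rewrite mulrAC ler_pdivlMr // mulrC.
by rewrite -ler_pdivrMr // mulrAC.
Qed.

Lemma Delta_differentiable : differentiable ('valL_0 (@Delta R E U) : E -> Gv U) (\val x).
Proof.
pose L := Operator (bounded_is_operator dDelta_linear dDelta_bound).
apply: (@rnorm_differentiable _ _ _ _ _ L) => e e0.
(* Below [e / C] the quadratic remainder [C * rnorm h ^+ 2] is at most [e * rnorm h]. *)
exists (Num.min r (e / C)); first by rewrite lt_min r0 divr_gt0.
move=> h; rewrite lt_min => /andP[hr he].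
have [y [yE _ _]] := taylor (ltW hr).
rewrite -yE !valL0E (le_trans (dDelta_approx yE (ltW hr))) //.
rewrite expr2 mulrA ler_wpM2r ?rnorm_ge0 //.
by rewrite ltW // mulrC -ltr_pdivlMr.
Qed.

End derivative.

Lemma Delta_Hv : Hv (@Delta R E U) /\ wnorm (@Delta R E U) <= 1.
Proof.
have b (x : U) : weight x * rnorm (Delta x) <= 1.
  by rewrite -ler_pdivlMl ?weight_gt0 // mulr1; exact: rnorm_evaluation.
split; last exact: wnorm_le.
split; last by exists 1 => _ [x _ <-].
move=> x; have [r [C [r0 C0 rP]]] := Hv_taylor x.
exact: Delta_differentiable rP.
Qed.

End DeltaHolomorphic.

(** * Left-hand quotients *)

Section Quotient.
Context {R : realType} (A : operator_class R) (I : whol_class R).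
Hypotheses (hA : normed_operator_ideal A) (hI : normed_whol_ideal I).
Local Open Scope ereal_scope.

Lemma norm_comp_left_quotient (E F G : completeNormedModType R[i]) (U : weighted_open E)
    (g : U -> F) (T : operator F G) :
  op_mem A T -> wh_mem (left_quotient A I) g ->
  wh_norm I (T \o g) <= op_norm A T * wh_norm (left_quotient A I) g.
Proof.
move=> AT [Hg gq]; have [_ _ _ Afin Age0 _ Ahom Adef] := op_normed hA F G.
have [_ [_ _ Iscale Ifin _ _ Ihom _] _] := wh_normed hI U G.
have ITg := gq _ _ AT.
have [r rE] : exists r, op_norm A T = r%:E by exists (fine (op_norm A T)); rewrite fineK ?Afin.
have [m mE] : exists m, wh_norm I (T \o g) = m%:E.
  by exists (fine (wh_norm I (T \o g))); rewrite fineK ?Ifin.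
have r0 : (0 <= r)%R by rewrite -lee_fin -rE Age0.
(* An operator of norm 0 cannot be normalized, but then [T] is 0 and both sides vanish. *)
have [r_eq0|rN0] := eqVneq r 0%R.
  have T0 : T = 0%R by apply: Adef; rewrite // rE r_eq0.
  rewrite rE r_eq0 mul0e (_ : T \o g = 0 *: (T \o g))%R; last first.
    by apply/funext => x; rewrite T0 /= [RHS]scale0r.
  by rewrite Ihom // normr0 /= mul0e.
have {}r0 : (0 < r)%R by rewrite lt_neqAle eq_sym rN0.
pose a : R[i] := (r^-1)%:C.
have Ra : complex.Re `|a|%R = (r^-1)%R.
  by rewrite -[LHS]/(rnorm a) rnorm_real gtr0_norm ?invr_gt0.
have aT : op_mem A (a *: T)%R by case: (op_normed hA F G) => _ _ + _ _ _ _ _; apply.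
rewrite rE -lee_pdivrMl //; apply: ereal_sup_ubound.
exists G, (a *: T)%R; split=> //.
  by rewrite Ahom // Ra rE -EFinM mulVf.
by rewrite -[RHS]/(wh_norm I (a *: (T \o g))%R) Ihom // Ra.
Qed.

Hypothesis hLP : linearization_property I A.

(** By [linearization_unique] the linearization property for [B \o Delta] speaks of [B] itself, so
    the quotient norm is a supremum of values [op_norm A B <= 1]. *)
Lemma Delta_left_quotient (E : completeNormedModType R[i]) (U : weighted_open E) :
  wh_mem (left_quotient A I) (@Delta R E U) /\
  wh_norm (left_quotient A I) (@Delta R E U) <= 1.
Proof.
have [HD _] := Delta_Hv U.
have lp (G : completeNormedModType R[i]) (B : operator (Gv U) G) : op_mem A B ->
    wh_mem I (B \o @Delta R E U) /\ wh_norm I (B \o @Delta R E U) = op_norm A B.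
  move=> AB; have [[_ h1] h2] := hLP (Hv_comp B HD).1.
  by rewrite linearization_unique in h1 h2; split; [exact: h1|exact/h2/h1].
split; first by split=> // G B /lp[].
by apply: ge_ereal_sup => _ [G [B [AB B1 ->]]]; rewrite (lp _ _ AB).2.
Qed.

End Quotient.

Theorem theorem2p9 (R : realType) (A : operator_class R) (I : whol_class R)
    (hA : normed_operator_ideal A) (hI : normed_whol_ideal I)
    (hLP : linearization_property I A) :
  whol_class_eq (composition_ideal A (left_quotient A I)) I.
Proof.
move=> E U F f.
have fact : wh_mem I f -> [/\ op_mem A (linearization f),
    f = linearization f \o @Delta R E U &
    wh_norm I f = op_norm A (linearization f)].
  move=> If; have [sub _ _] := wh_normed hI U F.
  have Hf := sub _ If; have [[h1 _] h2] := hLP E U F f Hf.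
  by split; [exact: h1|rewrite linearizationE|exact: h2].
have [QD D1] := Delta_left_quotient hLP U.
have mem : wh_mem (composition_ideal A (left_quotient A I)) f <-> wh_mem I f.
  split=> [[G [T [g [AT [_ gq] ->]]]]|/fact[AT fE _]]; first exact: gq.
  by exists (Gv U), (linearization f), (@Delta R E U).
split=> // /mem/fact[AT fE fn]; apply/eqP; rewrite eq_le; apply/andP; split.
  (* The factorization through [Delta] is one competitor in the infimum. *)
  rewrite fn; apply: le_trans (_ : (op_norm A (linearization f) *
    wh_norm (left_quotient A I) (@Delta R E U) <= _)%E).
    by apply: ereal_inf_lbound; exists (Gv U), (linearization f), (@Delta R E U).
  rewrite -[leRHS]mule1 lee_wpmul2l //.
  by case: (op_normed hA (Gv U) F) => _ _ _ _ + _ _ _; apply.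
(* Conversely, the quotient norm bounds the norm of [f] by the cost of every factorization. *)
apply: le_ereal_inf_tmp => _ [G [T [g [AT' gq fE' ->]]]].
by rewrite [in leLHS]fE'; exact: norm_comp_left_quotient.
Qed.
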